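(* For every $s\in(1/2,1)$ there exists a constant $\vartheta_s>0$, depending only on $s$, such that for every $k\in\mathbb{N}\setminus\{0\}$ and every open set $\Omega\subseteq\mathbb{R}^2$ which is multiply connected of order $k$, we have \[ \lambda_1^s(\Omega)\ \ge\ \frac{\vartheta_s}{k^s}\left(\frac{1}{r_\Omega}\right)^{2s}. \] Moreover, the constant $\vartheta_s$ has the following asymptotic behaviours: \[ 0<\liminf_{s\searrow 1/2}\frac{\vartheta_s}{2s-1}\le\limsup_{s\searrow 1/2}\frac{\vartheta_s}{2s-1}<+\infty \qquad\text{and}\qquad 0<\liminf_{s\nearrow 1}(1-s)\,\vartheta_s\le\limsup_{s\nearrow 1}(1-s)\,\vartheta_s<+\infty . \]
   Context: For $0<s<1$ and $u\in C^\infty_0(\mathbb{R}^2)$ (smooth, compactly supported), set \[ [u]_{W^{s,2}(\mathbb{R}^2)}=\left(\iint_{\mathbb{R}^2\times\mathbb{R}^2}\frac{|u(x)-u(y)|^2}{|x-y|^{2+2s}}\,dx\,dy\right)^{1/2}. \] For an open set $\Omega\subseteq\mathbb{R}^2$, \[ \lambda^s_1(\Omega):=\inf_{u\in C^\infty_0(\Omega)\setminus\{0\}}\frac{[u]^2_{W^{s,2}(\mathbb{R}^2)}}{\|u\|^2_{L^2(\Omega)}}, \] where functions in $C^\infty_0(\Omega)$ are extended by zero to $\mathbb{R}^2$. The inradius of $\Omega$ is $r_\Omega:=\sup\{r>0: \exists\,x_0\in\Omega \text{ with } B_r(x_0)\subseteq\Omega\}$, where $B_r(x_0)$ is the open disk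 of center $x_0$ and radius $r$; if $r_\Omega=+\infty$, then $1/r_\Omega$ is understood as $0$. Let $(\mathbb{R}^2)^*$ be the one-point compactification of $\mathbb{R}^2$. An open connected set $\Omega\subseteq\mathbb{R}^2$ is called multiply connected of order $k$ if its complement in $(\mathbb{R}^2)^*$ has exactly $k$ connected components. *)

(* Defs.v *)
From HB Require Import structures.
From mathcomp Require Import all_boot all_order all_algebra.
From mathcomp Require Import all_classical all_reals all_analysis.

Set Implicit Arguments.
Unset Strict Implicit.
Unset Printing Implicit Defensive.

Import Order.TTheory GRing.Theory Num.Theory.
Import numFieldTopology.Exports numFieldNormedType.Exports.

Local Open Scope classical_set_scope.
Local Open Scope ring_scope.

(* The norm provided by the library on R * R is the max norm: it induces the
   right topology, but disks and |x - y| have to be Euclidean. *)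
Definition enorm2 (R : realType) (x : R * R) : R :=
  Num.sqrt (x.1 ^+ 2 + x.2 ^+ 2).

Definition disk (R : realType) (x0 : R * R) (r : R) : set (R * R) :=
  [set x | enorm2 (x - x0) < r].

Definition lebesgue_measure2 (R : realType) :
    set (measurableTypeR R * measurableTypeR R)%type -> \bar R :=
  (@lebesgue_measure R \x @lebesgue_measure R)%E.

HB.instance Definition _ (R : realType) := Measure.on (@lebesgue_measure2 R).
(* A sigma-finite structure on lebesgue_measure2 is what makes its product with
   itself a measure; the library's instance for \x is not found by inference. *)
Lemma lebesgue_measure2_sigma_finite (R : realType) :
  sigma_finite setT (@lebesgue_measure2 R).
Proof.
have /sigma_finiteP[F [TF ndF Foo]] :=
  sigma_finiteT (@lebesgue_measure R : {sigma_finite_measure set _ -> \bar R}).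
exists (fun n => F n `*` F n).
  rewrite -setXTT TF predeqE => -[x y]; split.
    move=> [/= [n _ Fnx] [k _ Fky]]; exists (maxn n k) => //; split.
    - by move: x Fnx; exact/subsetPset/ndF/leq_maxl.
    - by move: y Fky; exact/subsetPset/ndF/leq_maxr.
  by move=> [n _ []/= ? ?]; split; exists n.
move=> k; have [? ?] := Foo k.
split; first exact: measurableX.
by rewrite /lebesgue_measure2 product_measure1E// lte_mul_pinfty// ge0_fin_numE.
Qed.

HB.instance Definition _ (R : realType) :=
  Measure_isSigmaFinite.Build _ _ _ (@lebesgue_measure2 R)
    (@lebesgue_measure2_sigma_finite R).

(* false is the first coordinate, true the second. *)
Definition partial (R : realType) (i : bool) (u : R * R -> R) : R * R -> R :=
  'D_(if i then (0, 1) else (1, 0)) u.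

Definition partials (R : realType) (l : seq bool) (u : R * R -> R) :
  R * R -> R := foldr (@partial R) u l.

(* All iterated partial derivatives exist everywhere and are continuous.  The
   differentiability conjunct is needed because 'D_v is a total operator. *)
Definition smooth (R : realType) (u : R * R -> R) : Prop :=
  forall l : seq bool, continuous (partials l u) /\
    forall (i : bool) (x : R * R),
      derivable (partials l u) x (if i then (0, 1) else (1, 0)).

Definition support2 (R : realType) (u : R * R -> R) : set (R * R) :=
  closure [set x | u x != 0].

(* C^oo_0(Omega), each function being identified with its extension by zero,
   which is smooth on the whole plane. *)
Definition test_function (R : realType) (Omega : set (R * R)) :
    set (R * R -> R) :=
  [set u | [/\ smooth u, compact (support2 u) & support2 u `<=` Omega]].

Definition gagliardo (R : realType) (s : R) (u : R * R -> R) : \bar R :=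
  ((\int[(@lebesgue_measure2 R \x @lebesgue_measure2 R)%E]_z
     (`|u z.1 - u z.2| ^+ 2 / enorm2 (z.1 - z.2) `^ (2 + 2 * s))%:E)
   `^ (2^-1)%R)%E.

Definition norm_L2 (R : realType) (Omega : set (R * R)) (u : R * R -> R) :
    \bar R :=
  Lnorm (@lebesgue_measure2 R) 2%:E (EFin \o (u \_ Omega)).

Definition lambda1 (R : realType) (s : R) (Omega : set (R * R)) : \bar R :=
  ereal_inf [set (gagliardo s u ^+ 2 / norm_L2 Omega u ^+ 2)%E
            | u in test_function Omega `\ cst 0].

(* In the extended reals (+oo)^-1 = 0, the convention wanted for 1 / r_Omega. *)
Definition inradius (R : realType) (Omega : set (R * R)) : \bar R :=
  ereal_sup [set r%:E | r in
    [set r : R | 0 < r /\ exists2 x0, Omega x0 & disk x0 r `<=` Omega]].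

Definition components (T : topologicalType) (A : set T) : set (set T) :=
  [set connected_component A x | x in A].

(* To be used on an open Omega. *)
Definition multiply_connected (R : realType) (k : nat) (Omega : set (R * R)) :
    Prop :=
  connected Omega /\
  (components (~` (Some @` Omega :
     set (one_point_compactification (R * R)%type))) #= `I_k)%card.

(* Main.v *)
Require Import Defs.
From HB Require Import structures.
From mathcomp Require Import all_boot all_order all_algebra.
From mathcomp Require Import all_classical all_reals all_analysis.
From mathcomp Require Import measurable_realfun.
From mathcomp Require Import ring lra zify.

Import Order.TTheory GRing.Theory Num.Theory.
Import numFieldTopology.Exports numFieldNormedType.Exports.

Local Open Scope classical_set_scope.
Local Open Scope ring_scope.

Set Implicit Arguments.
Unset Strict Implicit.
Unset Printing Implicit Defensive.

(** The constant can be taken to be theta_s = (2 s - 1) / ((1 - s) C) with C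
absolute, so that everything rests on one Poincare inequality: a test function
u of Omega satisfies
  int u^2 <= C (1 - s) / (2 s - 1) * k^s * r^(2 s) * [u]^2,
r being the inradius ([integral_sq_le_gagliardo]).  The Euclidean norm is
traded for the max norm in the Gagliardo kernel at the price of a factor 4.

Topology enters through a pigeonhole argument.  Put rho = 2 r, so that every
disk of radius rho meets the complement of Omega.  Tile the plane by squares Q
of side L = 6 rho N, with N^2 between 2 k and 8 k, and cut each Q into N^2
cells of side 6 rho.  Choose in every cell a point p of the complement at
distance less than rho from the centre.  There are k components of the
complement in the sphere, so for all but at most k cells, hence for at least
half of them, the component of p also contains the point chosen in another
cell.  A connected set cannot leave p without meeting the boundary of every
small square centred at p ([many_cells_crossed]).  Each of these boundaries
lies on four lines, so that for every radius t < 2 rho one of the four lines at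
distance t from p carries, inside the cell, a zero of u.

On a segment J of length l carrying a zero z of u one has
  int_J u^2 <= C l^(2 s) / (2 s - 1) * int_J E,
where E(x) is the integral of |u(x) - u(y)|^2 / |x - y|^(2 + 2 s) over the y at
distance at most l from x ([integral_sq_zero_on_line]).  This is where s > 1/2
is needed: the mean of u^2 on J is compared with its means on halved intervals
shrinking to z.  The telescoping sum is handled by Cauchy-Schwarz with weights
2^(-m (2 s - 1)), whose sum gives the factor 1 / (2 s - 1), and the scales add
up to a single copy of the kernel.  Every interval of the chain is compared
with a square of the same size, which is how the two-dimensional energy E
enters.

To bound the integral of u^2 on Q, compare the points of Q with the points of
such segments and integrate over t and over the good cells.  As these fill a
fixed proportion of Q, the comparison costs L^(2 s), which is of order k^s r^(2
s) ([le_integral_sq_square]); comparing with a single cell would have cost a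
full factor k.  Summing over the tiling gives the inequality without the factor
1 - s, but with the energy restricted to |x - y| <= L.

The factor 1 - s comes from comparing exponents.  Inserting the midpoint of x
and y shows that the energy at range d is at most 2^(2 - 2 s) times the energy
at range d / 2 ([total_energy_doubling]), so the pairs with |x - y| between d /
2 and d carry only a fraction of order 1 - s of it.  Summing over dyadic ranges
bounds the energy of exponent 5/8 by (1 - s) times that of exponent s
([total_energy_lower_exponent]), and for s >= 3/4 the inequality of exponent
5/8 yields the one of exponent s. *)

(** * Measurability and changes of variables on the plane *)

Lemma prod_normE (R : realType) (x : R * R) : `|x| = Num.max `|x.1| `|x.2|.
Proof. by []. Qed.

Lemma prod_norm_lt (R : realType) (x : R * R) (r : R) :
  (`|x| < r) = (`|x.1| < r) && (`|x.2| < r).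
Proof. by rewrite prod_normE gt_max. Qed.

Lemma prod_norm_le (R : realType) (x : R * R) (r : R) :
  (`|x| <= r) = (`|x.1| <= r) && (`|x.2| <= r).
Proof. by rewrite prod_normE ge_max. Qed.

(** Unions are indexed by [nat] through [unpickle], codes of nothing being sent
to the empty set. *)
Lemma bigcupT_measurable_count d (T : measurableType d) (I : countType)
    (F : I -> set T) :
  (forall i, measurable (F i)) -> measurable (\bigcup_i F i).
Proof.
move=> mF; pose G n := if unpickle n is Some i then F i else set0.
have -> : \bigcup_i F i = \bigcup_n G n.
  rewrite eqEsubset; split => [x [i _ Fix]|x [n _]]; rewrite /G.
    by exists (pickle i) => //; rewrite pickleK.
  by case: unpickle => // i Fix; exists i.
by apply: bigcupT_measurable => n; rewrite /G; case: unpickle.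
Qed.

(** The sigma-algebra on the plane is the product one, not the Borel one by
definition; an open set belongs to it as the union of the countably many
rational boxes that it contains. *)
Lemma open_measurable2 (R : realType) (U : set (R * R)) :
  open U -> measurable (U : set (measurableTypeR R * measurableTypeR R)).
Proof.
move=> oU.
pose B (q : rat * rat * rat) : set (measurableTypeR R * measurableTypeR R) :=
  ball (ratr q.1.1 : R) (ratr q.2) `*` ball (ratr q.1.2 : R) (ratr q.2).
have -> : U = \bigcup_(q in [set q | B q `<=` U]) B q.
  rewrite eqEsubset; split; last by move=> x [q /= qU]; exact: qU.
  move=> x Ux; have /(@nbhs_ballP R) [e /= e0 xU] :=
    open_nbhs_nbhs (conj oU Ux).
  have [r] := rat_in_itvoo (divr_gt0 e0 (ltr0n R 2)).
  rewrite in_itv/= => /andP[r0 re].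
  have near1 (y : R) : exists q : rat, `|ratr q - y| < ratr r.
    have [q] := @rat_in_itvoo R (y - ratr r) (y + ratr r) ltac:(lra).
    rewrite in_itv/= => /andP[q1 q2]; exists q.
    by rewrite ltr_norml; apply/andP; split; lra.
  have [[p Hp] [q Hq]] := (near1 x.1, near1 x.2).
  exists (p, q, r) => /=.
    move=> y [/= y1 y2]; apply: xU; split => /=.
      by move: y1 Hp; rewrite /ball/= !ltr_norml; lra.
    by move: y2 Hq; rewrite /ball/= !ltr_norml; lra.
  by split.
rewrite bigcup_mkcond; apply: bigcupT_measurable_count => q.
case: ifPn => // _; apply: measurableX; exact: open_measurable (ball_open _ _).
Qed.

Lemma continuous_measurable2 (R : realType) (u : R * R -> R) :
  continuous u ->
  measurable_fun [set: measurableTypeR R * measurableTypeR R] u.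
Proof.
move=> /continuousP cu; apply: (measurability _ (RGenOpens.measurableE R)).
move=> _ [_ [a [b ->] <-]]; rewrite setTI; apply: open_measurable2.
exact/cu/interval_open.
Qed.

(** The image of the Lebesgue measure under an affine map, rescaled by [`|a|],
agrees with it on half-open intervals, which determine it. *)
Lemma ge0_integral_affine (R : realType) (a b : R)
    (f : measurableTypeR R -> \bar R) :
  a != 0 -> measurable_fun [set: measurableTypeR R] f ->
  (forall x, (0 <= f x)%E) ->
  (\int[@lebesgue_measure R]_x f (a * x + b)%R =
    `|a|^-1%:E * \int[@lebesgue_measure R]_x f x)%E.
Proof.
move=> a0 mf f0.
pose phi (x : measurableTypeR R) : measurableTypeR R := a * x + b.
have mphi : measurable_fun setT phi.
  apply: continuous_measurable_fun => x /=.
  by apply: cvgD; [apply: cvgM => //; exact: cvg_cst|exact: cvg_cst].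
have := @ge0_integral_pushforward _ _ _ _ R phi mphi (@lebesgue_measure R) setT
  f measurableT mf (fun x _ => f0 x).
rewrite preimage_setT => <-.
have an0 : 0 <= `|a| by [].
pose nu0 := mscale (NngNum an0) (pushforward (@lebesgue_measure R) phi).
pose nu := nu0 mphi.
have nuE : forall A, measurable A -> lebesgue_measure A = nu A.
  apply: lebesgue_measure_unique => _ [[x y]] _ <-.
  change (lebesgue_measure `]x, y] =
    `|a|%:E * lebesgue_measure (phi @^-1` `]x, y]%classic))%E.
  rewrite lebesgue_measure_itv/= lte_fin.
  have [a_gt0|a_lt0] : 0 < a \/ a < 0 by move: a0; rewrite neq_lt => /orP[];
    tauto.
    have -> : phi @^-1` `]x, y]%classic = `](x - b) / a, (y - b) / a]%classic.
      apply/seteqP; split => t /=; rewrite /phi !in_itv/=;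
      by rewrite ltr_pdivrMr// ler_pdivlMr// mulrC ltrBlDr lerBrDr.
    rewrite lebesgue_measure_itv/= lte_fin ltr_pM2r ?invr_gt0// ltrD2r.
    case: ifPn => xy; last by rewrite mule0.
    by rewrite gtr0_norm// -EFinB -EFinM; congr EFin; field.
  have -> : phi @^-1` `]x, y]%classic = `[(y - b) / a, (x - b) / a[%classic.
    apply/seteqP; split => t /=; rewrite /phi !in_itv/=;
    by rewrite ltr_ndivlMr// ler_ndivrMr// mulrC ltrBlDr lerBrDr andbC.
  rewrite lebesgue_measure_itv/= lte_fin ltr_nM2r ?invr_lt0// ltrD2r.
  case: ifPn => xy; last by rewrite mule0.
  by rewrite ltr0_norm// -EFinB -EFinM; congr EFin; field.
rewrite [in RHS](eq_measure_integral nu) => [|A mA _]; last exact: nuE.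
rewrite ge0_integral_mscale//= muleA -EFinM mulVf ?mul1e// normr_eq0//.
Qed.

(** * Integrals over rectangles and comparison of means *)

Section product_integrals.
Context d1 d2 (X : measurableType d1) (Y : measurableType d2) (R : realType).
Variables (mu : {sigma_finite_measure set X -> \bar R})
          (nu : {sigma_finite_measure set Y -> \bar R}).
Local Open Scope ereal_scope.

Lemma measurable_patchX (h : X * Y -> \bar R) (A : set X) (B : set Y) :
  measurable A -> measurable B -> measurable_fun setT h ->
  measurable_fun setT (h \_ (A `*` B)).
Proof.
move=> mA mB mh; apply/(measurable_restrictT _ _).1; first exact: measurableX.
exact: measurable_funS mh.
Qed.

Lemma patchX_integral (h : X * Y -> \bar R) (A : set X) (B : set Y) x :
  \int[nu]_y (h \_ (A `*` B)) (x, y) =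
  ((fun x => \int[nu]_(y in B) h (x, y)) \_ A) x.
Proof.
rewrite [RHS]/patch; case: ifPn => [|/negP] xA.
  rewrite [RHS]integral_mkcond; apply: eq_integral => y _.
  by rewrite /patch in_setX/= xA.
by apply: integral0_eq => y _;
  rewrite /patch in_setX/= (negbTE (introN idP xA)).
Qed.

Lemma measurable_integral_section (h : X * Y -> \bar R) (B : set Y) :
  measurable B -> measurable_fun setT h -> (forall z, 0 <= h z) ->
  measurable_fun setT (fun x => \int[nu]_(y in B) h (x, y)).
Proof.
move=> mB mh h0.
have := measurable_patchX measurableT mB mh.
move=> /(@measurable_fun_fubini_tonelli_F _ _ X Y R nu).
move=> /(_ (fun z => erestrict_ge0 (fun z _ => h0 z) z)).
apply: eq_measurable_fun => x _.
by rewrite /fubini_F patchX_integral patch_setT.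
Qed.

Lemma tonelli_rectangle (h : X * Y -> \bar R) (A : set X) (B : set Y) :
  measurable A -> measurable B -> measurable_fun setT h ->
  (forall z, 0 <= h z) ->
  \int[mu]_(x in A) \int[nu]_(y in B) h (x, y) =
  \int[(mu \x nu)]_(z in A `*` B) h z.
Proof.
move=> mA mB mh h0; rewrite [RHS]integral_mkcond fubini_tonelli1.
- rewrite [LHS]integral_mkcond; apply: eq_integral => x _.
  by rewrite /fubini_F patchX_integral.
- exact: measurable_patchX.
- exact: erestrict_ge0.
Qed.

End product_integrals.

Lemma tonelli_swap d1 d2 (X : measurableType d1) (Y : measurableType d2)
    (R : realType) (mu : {sigma_finite_measure set X -> \bar R})
    (nu : {sigma_finite_measure set Y -> \bar R})
    (h : X * Y -> \bar R) (A : set X) (B : set Y) :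
  measurable A -> measurable B -> measurable_fun setT h ->
  (forall z, 0 <= h z)%E ->
  (\int[mu]_(x in A) \int[nu]_(y in B) h (x, y) =
   \int[nu]_(y in B) \int[mu]_(x in A) h (x, y))%E.
Proof.
move=> mA mB mh h0; rewrite tonelli_rectangle// integral_mkcond fubini_tonelli2.
- rewrite [RHS]integral_mkcond; apply: eq_integral => y _; rewrite /fubini_G.
  transitivity (\int[mu]_x ((fun z => h (z.2, z.1)) \_ (B `*` A)) (y, x))%E.
    apply: eq_integral => x _; rewrite /patch !in_setX/=.
    by rewrite andbC.
  by rewrite patchX_integral.
- exact: measurable_patchX.
- exact: erestrict_ge0.
Qed.

(** The only inequality used to compare the mean of f^2 on A with the mean of
g^2 on B: integrate f^2 <= (al + be) ((f - g)^2 / al + g^2 / be), which is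
Cauchy-Schwarz.  The weights al and be stay free because the chain of
intervals below has to optimise them. *)
Lemma integral_sq_pair d1 d2 (X : measurableType d1) (Y : measurableType d2)
    (R : realType) (mu : {sigma_finite_measure set X -> \bar R})
    (nu : {sigma_finite_measure set Y -> \bar R})
    (A : set X) (B : set Y) (f : X -> R) (g : Y -> R) (al be : R) :
  measurable A -> measurable B ->
  measurable_fun setT f -> measurable_fun setT g -> 0 < al -> 0 < be ->
  (nu B * \int[mu]_(x in A) (f x ^+ 2)%:E <=
   ((al + be) / al)%:E *
     (\int[mu]_(x in A) \int[nu]_(y in B) ((f x - g y) ^+ 2)%:E) +
   ((al + be) / be)%:E * (mu A * \int[nu]_(y in B) (g y ^+ 2)%:E))%E.
Proof.
move=> mA mB mf mg al0 be0.
have mh : measurable_fun setT (fun z : X * Y => ((f z.1 - g z.2) ^+ 2)%:E).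
  apply/measurable_EFinP/measurable_funX/measurable_funB.
    by apply: measurableT_comp => //; exact: measurable_fst.
  by apply: measurableT_comp => //; exact: measurable_snd.
have mf2 : measurable_fun setT (fun x => (f x ^+ 2)%:E).
  exact/measurable_EFinP/measurable_funX.
have mg2 : measurable_fun setT (fun x => (g x ^+ 2)%:E).
  exact/measurable_EFinP/measurable_funX.
have sq0 (T : Type) (k : T -> R) (x : T) : (0 <= (k x ^+ 2)%:E)%E.
  by rewrite lee_fin sqr_ge0.
have mH := measurable_integral_section nu mB mh (fun z => sq0 _ (fun z :
  X * Y => f z.1 - g z.2) z).
have H0 x : (0 <= \int[nu]_(y in B) ((f x - g y) ^+ 2)%:E)%E.
  by apply: integral_ge0 => y _; rewrite lee_fin sqr_ge0.
set G := (\int[nu]_(y in B) (g y ^+ 2)%:E)%E.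
have G0 : (0 <= G)%E by apply: integral_ge0 => y _; rewrite lee_fin sqr_ge0.
have c1 : 0 <= (al + be) / al by apply: divr_ge0; lra.
have c2 : 0 <= (al + be) / be by apply: divr_ge0; lra.
have -> : (mu A * G = \int[mu]_(x in A) cst G x)%E.
  by rewrite integral_cst// muleC.
rewrite -!ge0_integralZl//; try exact: measurable_funTS.
rewrite -ge0_integralD//; first last.
- by move=> x _; rewrite mule_ge0.
- by apply: measurable_funTS; exact: measurable_funeM.
- by move=> x _; rewrite mule_ge0.
apply: ge0_le_integral => //.
- by move=> x _; rewrite mule_ge0// lee_fin sqr_ge0.
- by apply: measurable_funTS; exact: measurable_funeM.
- apply: measurable_funTS; apply: emeasurable_funD.
    exact: measurable_funeM.
  exact: measurable_cst.
move=> x _.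
have mhx : measurable_fun setT (fun y => ((f x - g y) ^+ 2)%:E).
  exact/measurable_EFinP/measurable_funX/measurable_funB.
rewrite muleC -integral_cst// -!ge0_integralZl//; try exact: measurable_funTS;
  try by move=> y _; rewrite lee_fin sqr_ge0.
rewrite -ge0_integralD//; first last.
- by apply: measurable_funTS; exact: measurable_funeM.
- by move=> y _; rewrite mule_ge0// lee_fin sqr_ge0.
- by apply: measurable_funTS; exact: measurable_funeM.
- by move=> y _; rewrite mule_ge0// lee_fin sqr_ge0.
apply: ge0_le_integral => //.
- by move=> y _; rewrite lee_fin sqr_ge0.
- by apply: measurable_funTS; apply: emeasurable_funD => //;
    exact: measurable_funeM.
move=> y _; rewrite -!EFinM -EFinD lee_fin -subr_ge0.
have -> : (al + be) / al * (f x - g y) ^+ 2 + (al + be) / be * g y ^+ 2 - f x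
  ^+ 2
  = (be * (f x - g y) - al * g y) ^+ 2 / (al * be).
  by field; rewrite !gt_eqF.
by rewrite divr_ge0 ?sqr_ge0// mulr_ge0 ?ltW.
Qed.

(** * Truncated energy and halved intervals *)

Lemma measurable_dist2 (R : realType) :
  measurable_fun setT (fun z : (measurableTypeR R * measurableTypeR R) *
    (measurableTypeR R * measurableTypeR R) => `|z.1 - z.2 : R * R|).
Proof.
pose T : Type := measurableTypeR R * measurableTypeR R.
have m1 : measurable_fun setT (fun z : T * T => z.1.1 - z.2.1).
  apply: measurable_funB; apply: measurableT_comp => //; exact: measurable_fst.
have m2 : measurable_fun setT (fun z : T * T => z.1.2 - z.2.2).
  apply: measurable_funB; apply: measurableT_comp => //; exact: measurable_snd.
by apply: measurable_maxr; apply: measurableT_comp.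
Qed.

(** The singular kernel is cut off at range d, and taken with respect to the max
norm so that all regions involved are products of intervals.  On the diagonal
the kernel takes a junk value, which the factor (u x - u y)^2 kills. *)
Definition energy_density (R : realType) (u : R * R -> R) (p d : R)
    (z : (measurableTypeR R * measurableTypeR R) *
         (measurableTypeR R * measurableTypeR R)) : R :=
  if `|z.1 - z.2 : R * R| <= d
  then (u z.1 - u z.2) ^+ 2 * `|z.1 - z.2 : R * R| `^ (- p) else 0.

Definition energy (R : realType) (u : R * R -> R) (p d : R) (x : R * R) :
    \bar R :=
  (\int[@lebesgue_measure2 R]_y (energy_density u p d (x, y))%:E)%E.

Lemma energy_density_ge0 (R : realType) (u : R * R -> R) p d z :
  0 <= energy_density u p d z.
Proof.
by rewrite /energy_density; case: ifP => // _;
  rewrite mulr_ge0 ?sqr_ge0 ?powR_ge0.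
Qed.

Lemma measurable_energy_density (R : realType) (u : R * R -> R) p d :
  measurable_fun [set: measurableTypeR R * measurableTypeR R] u ->
  measurable_fun setT (energy_density u p d).
Proof.
move=> mu.
apply: measurable_fun_ifT.
- apply: measurable_fun_ler; [exact: measurable_dist2|exact: measurable_cst].
- apply: measurable_funM.
    apply/measurable_funX/measurable_funB.
      by apply: measurableT_comp => //; exact: measurable_fst.
    by apply: measurableT_comp => //; exact: measurable_snd.
  apply: (measurableT_comp (measurable_powR (- p)) (@measurable_dist2 R)).
- exact: measurable_cst.
Qed.

Lemma energy_ge0 (R : realType) (u : R * R -> R) p d x :
  (0 <= energy u p d x)%E.
Proof.
by apply: integral_ge0 => y _; rewrite lee_fin energy_density_ge0.
Qed.

Lemma measurable_energy (R : realType) (u : R * R -> R) p d :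
  measurable_fun [set: measurableTypeR R * measurableTypeR R] u ->
  measurable_fun [set: measurableTypeR R * measurableTypeR R] (energy u p d).
Proof.
move=> mu; apply: (@measurable_integral_section _ _ _ _ R
  (@lebesgue_measure2 R) (fun z => (energy_density u p d z)%:E)) => //.
  by apply/measurable_EFinP; apply: measurable_energy_density.
by move=> z; rewrite lee_fin energy_density_ge0.
Qed.

Lemma le_energy (R : realType) (u : R * R -> R) p d d' x :
  measurable_fun [set: measurableTypeR R * measurableTypeR R] u ->
  d <= d' -> (energy u p d x <= energy u p d' x)%E.
Proof.
move=> mu dd'.
have me e : measurable_fun setT (fun y => (energy_density u p e (x, y))%:E).
  apply/measurable_EFinP.
  by apply: (measurableT_comp (measurable_energy_density _ _ _)).
apply: ge0_le_integral => //.
- by move=> y _; rewrite lee_fin energy_density_ge0.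
- move=> y _; rewrite lee_fin /energy_density; case: ifP => [|_].
    by move=> /= /le_trans ->.
  by case: ifP => //= _; rewrite mulr_ge0 ?sqr_ge0 ?powR_ge0.
Qed.

Lemma half_dyadic (R : realType) (l : R) n :
  l / 2 ^+ n = 2 * (l / 2 ^+ n.+1).
Proof. by rewrite exprS; field; rewrite expf_neq0. Qed.

(** Left endpoints of a chain of half-open intervals of lengths l / 2^n, each
one being the half of the previous one that contains z.  Half-open intervals
make the two halves disjoint and exhaustive. *)
Fixpoint halving (R : realType) (z b l : R) (n : nat) : R :=
  if n is n'.+1 then
    let b' := halving z b l n' in
    if z < b' + l / 2 ^+ n then b' else b' + l / 2 ^+ n
  else b.

Definition halving_itv (R : realType) (z b l : R) (n : nat) :
    set (measurableTypeR R) :=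
  `[halving z b l n, halving z b l n + l / 2 ^+ n[%classic.

Lemma halving_mem (R : realType) (z b l : R) n :
  b <= z < b + l -> halving z b l n <= z < halving z b l n + l / 2 ^+ n.
Proof.
move=> bz; elim: n => [|n /andP[zl zr]] /=; first by rewrite expr0 divr1.
have e := half_dyadic l n.
by case: ifP => [->|/negbT]; rewrite ?andbT// -leNgt => ->/=; lra.
Qed.

Lemma halving_itvS (R : realType) (z b l : R) n : 0 < l ->
  halving_itv z b l n.+1 `<=` halving_itv z b l n.
Proof.
move=> l0 t; rewrite /halving_itv /= !in_itv/=.
have e := half_dyadic l n.
have : 0 < l / 2 ^+ n.+1 by rewrite divr_gt0// exprn_gt0.
by case: ifP => _ ? /andP[? ?]; apply/andP; split; lra.
Qed.

(** A geometric sum is dominated by its last term, here the smallest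
l / 2^m that is still at least d. *)
Lemma sum_dyadic_powR (R : realType) (l d p : R) n : 0 < l -> 0 < d -> 1 <= p ->
  \sum_(m < n) (if d <= l / 2 ^+ m then (l / 2 ^+ m) `^ (- p) else 0)
  <= 2 * d `^ (- p).
Proof.
move=> l0 d0 p1.
have lm m : 0 < l / 2 ^+ m by rewrite divr_gt0// exprn_gt0.
have aS m : 2 * (l / 2 ^+ m) `^ (- p) <= (l / 2 ^+ m.+1) `^ (- p).
  have -> : l / 2 ^+ m.+1 = 2^-1 * (l / 2 ^+ m).
    by rewrite exprS invfM mulrCA.
  rewrite (powRM _ _ (ltW (lm m))) ?invr_ge0//.
  apply: ler_wpM2r; first exact: powR_ge0.
  rewrite -[2^-1]powR_inv1// -powRrM mulrNN mul1r.
  by rewrite -[leLHS]powRr1// ler_powR// ler1n.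
have S m : \sum_(i < m.+1) (l / 2 ^+ i) `^ (- p) <= 2 * (l / 2 ^+ m) `^ (- p).
  elim: m => [|m IH]; first by rewrite big_ord1;
    have := powR_ge0 (l / 2 ^+ 0) (-p); lra.
  by rewrite big_ord_recr/=; have := aS m; lra.
elim: n => [|n IH]; first by rewrite big_ord0 mulr_ge0 ?powR_ge0.
rewrite big_ord_recr/=; case: ifP => [dn|_]; last by rewrite addr0.
(* The n-th term is present and dominates all the previous ones. *)
apply: (@le_trans _ _ (2 * (l / 2 ^+ n) `^ (- p))).
  apply: le_trans (S n); rewrite big_ord_recr/= lerD2r.
  by apply: ler_sum => i _; case: ifP => // _; rewrite powR_ge0.
rewrite ler_pM2l// !powRN lef_pV2 ?posrE ?powR_gt0//.
by rewrite ge0_ler_powR// ?nnegrE; have := lm n; lra.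
Qed.

Definition halving_box (R : realType) (a z b l : R) (n : nat) :
    set (measurableTypeR R * measurableTypeR R) :=
  `[a, a + l / 2 ^+ n[%classic `*` halving_itv z b l n.

Lemma halving_itv_sub0 (R : realType) (z b l : R) n : 0 < l ->
  halving_itv z b l n `<=` `[b, b + l[%classic.
Proof.
move=> l0; elim: n => [|n IH]; first by rewrite /halving_itv/= expr0 divr1.
by move=> t /(halving_itvS l0) /IH.
Qed.

Lemma measurable_halving_itv (R : realType) (z b l : R) n :
  measurable (halving_itv z b l n).
Proof. exact: measurable_itv. Qed.

Lemma measurable_halving_box (R : realType) (a z b l : R) n :
  measurable (halving_box a z b l n).
Proof. by apply: measurableX; exact: measurable_itv. Qed.

Lemma measurable_sqdiff_line (R : realType) (u : R * R -> R) (a : R) :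
  measurable_fun [set: measurableTypeR R * measurableTypeR R] u ->
  measurable_fun setT (fun z : measurableTypeR R *
    (measurableTypeR R * measurableTypeR R) => (u (a, z.1) - u z.2) ^+ 2).
Proof.
move=> mu; apply/measurable_funX/measurable_funB.
  apply: (measurableT_comp mu (g := fun z => (a, z.1))).
  apply: measurable_fun_pair => //; exact: measurable_fst.
by apply: measurableT_comp => //; exact: measurable_snd.
Qed.

(** Two points at distance d lie together in the m-th interval and the m-th box
only if d <= l / 2^m, so the scales add up to a multiple of a single copy of
the kernel: no logarithm is lost. *)
Lemma sum_dyadic_pairs (R : realType) (u : R * R -> R) (a z b l p : R) n :
  measurable_fun [set: measurableTypeR R * measurableTypeR R] u ->
  0 < l -> 1 <= p ->
  (\sum_(m < n) ((l / 2 ^+ m) `^ (- p))%:E *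
     \int[@lebesgue_measure R]_(t in halving_itv z b l m)
       \int[@lebesgue_measure2 R]_(w in halving_box a z b l m)
         ((u (a, t) - u w) ^+ 2)%:E <=
   2%:E * \int[@lebesgue_measure R]_(t in `[b, (b + l)%R[) energy u p l (a,
     t))%E.
Proof.
move=> mu l0 p1.
pose T : Type := measurableTypeR R * (measurableTypeR R * measurableTypeR R).
pose q (x : T) : R := (u (a, x.1) - u x.2) ^+ 2.
pose dist (x : T) : R := `|(a, x.1) - x.2 : R * R|.
pose k (m : nat) (x : T) : R :=
  if dist x <= l / 2 ^+ m then (l / 2 ^+ m) `^ (- p) * q x else 0.
have mq : measurable_fun setT q by exact: measurable_sqdiff_line.
have memb : measurable_fun setT (fun x : T => ((a, x.1), x.2)).
  apply: measurable_fun_pair; last exact: measurable_snd.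
  apply: measurable_fun_pair => //; exact: measurable_fst.
have mdist : measurable_fun setT dist.
  exact: (measurableT_comp (@measurable_dist2 R) memb).
have mk m : measurable_fun setT (k m).
  apply: measurable_fun_ifT; last exact: measurable_cst.
    by apply: measurable_fun_ler => //; exact: measurable_cst.
  by apply: measurable_funM => //; exact: measurable_cst.
have q0 x : 0 <= q x by rewrite sqr_ge0.
have k0 m x : 0 <= k m x.
  by rewrite /k; case: ifP => // _; rewrite mulr_ge0 ?powR_ge0.
pose D : set T := `[b, b + l[%classic `*` setT.
have mD : measurable D by apply: measurableX => //; exact: measurable_itv.
pose de (x : T) := energy_density u p l ((a, x.1), x.2).
have mde : measurable_fun setT de.
  exact: (measurableT_comp (measurable_energy_density p l mu) memb).
apply: (@le_trans _ _ (\sum_(m < n)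
    \int[(@lebesgue_measure R \x @lebesgue_measure2 R)]_(x in D) (k m x)%:E)%E).
  apply: lee_sum => m _.
  rewrite (@tonelli_rectangle _ _ _ _ R lebesgue_measure (@lebesgue_measure2 R)
     (fun x => (q x)%:E))//; first last.
  - exact/measurable_EFinP.
  - exact: measurable_halving_box.
  - exact: measurable_halving_itv.
  have mB : measurable (halving_itv z b l m `*` halving_box a z b l m).
    apply: measurableX; [exact: measurable_halving_itv|exact:
      measurable_halving_box].
  rewrite -ge0_integralZl//; first last.
  - by rewrite lee_fin powR_ge0.
  - by move=> x _; rewrite lee_fin.
  - by apply: measurable_funTS; exact/measurable_EFinP.
  rewrite (_ : (\int[_]_(x in _) _)%E =
    (\int[(@lebesgue_measure R \x @lebesgue_measure2 R)]_(x in
      (halving_itv z b l m `*` halving_box a z b l m)) (k m x)%:E)%E);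
        last first.
    apply: eq_integral => -[t [w1 w2]]; rewrite inE => -[/= tJ [/= w1I w2J]].
    rewrite -EFinM /k ifT// /dist prod_norm_le/= !ler_norml.
    move: tJ w1I w2J; rewrite /halving_itv/= !in_itv/=.
    by move=> /andP[? ?] /andP[? ?] /andP[? ?]; lra.
  apply: ge0_subset_integral => //.
  - by apply: measurable_funTS; exact/measurable_EFinP.
  - by move=> x _; rewrite lee_fin.
  - by move=> [t w] [/= tJ _]; split => //=; exact: halving_itv_sub0 tJ.
rewrite -ge0_integral_sum//; first last.
- by move=> m x _; rewrite lee_fin.
- by move=> m; apply: measurable_funTS; exact/measurable_EFinP.
have -> : (\int[@lebesgue_measure R]_(t in `[b, (b + l)%R[) energy u p l (a,
  t))%E =
  (\int[(@lebesgue_measure R \x @lebesgue_measure2 R)]_(x in D) (de x)%:E)%E.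
  rewrite -(@tonelli_rectangle _ _ _ _ R lebesgue_measure (@lebesgue_measure2 R)
     (fun x => (de x)%:E))//.
  - exact/measurable_EFinP.
  - by move=> x; rewrite lee_fin energy_density_ge0.
rewrite -ge0_integralZl//; first last.
- by move=> x _; rewrite lee_fin energy_density_ge0.
- by apply: measurable_funTS; exact/measurable_EFinP.
apply: ge0_le_integral => //.
- by move=> x _; apply: sume_ge0 => m _; rewrite lee_fin.
- apply: measurable_funTS; apply: emeasurable_sum => m; exact/measurable_EFinP.
- by apply: measurable_funTS; apply: measurable_funeM; exact/measurable_EFinP.
move=> x _; rewrite sumEFin -EFinM lee_fin /de /energy_density/= -/(dist x)
  -/(q x).
have [d0|d0] := eqVneq (dist x) 0.
  have qx0 : q x = 0.
    move/eqP: d0; rewrite normr_eq0 subr_eq0 => /eqP e.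
    by rewrite /q e subrr expr0n.
  rewrite big1 => [|m _]; last by rewrite /k qx0 mulr0 if_same.
  by rewrite mulr_ge0//; case: ifP => // _; rewrite mulr_ge0 ?powR_ge0.
have {}d0 : 0 < dist x by rewrite lt_neqAle eq_sym d0/= normr_ge0.
have [dl|dl] := leP (dist x) l; last first.
  rewrite mulr0 big1// => m _; rewrite /k ifF//; apply/negbTE; rewrite -ltNge.
  apply: le_lt_trans dl; rewrite ler_pdivrMr ?exprn_gt0//.
  by apply: ler_peMr; [exact: ltW|rewrite exprn_ege1// ler1n].
rewrite mulrCA; apply: le_trans (ler_wpM2l (q0 x) (sum_dyadic_powR n l0 d0 p1)).
rewrite mulr_sumr; apply: ler_sum => m _; rewrite /k; case: ifP => _.
  by rewrite mulrC.
by rewrite mulr0.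
Qed.

(** * Functions vanishing at a point of a segment *)

Lemma lebesgue_measure2X (R : realType) (A B : set (measurableTypeR R)) :
  measurable A -> measurable B ->
  (@lebesgue_measure2 R (A `*` B) = lebesgue_measure A * lebesgue_measure B)%E.
Proof. by move=> mA mB; rewrite /lebesgue_measure2 product_measure1E. Qed.

Lemma lebesgue_measure_itvco (R : realType) (a l : R) : 0 < l ->
  (@lebesgue_measure R `[a, (a + l)%R[ = l%:E)%E.
Proof.
move=> l0; rewrite lebesgue_measure_itv/= lte_fin ltrDl l0 -EFinB.
by rewrite addrAC subrr add0r.
Qed.

Lemma ln2_ge_half (R : realType) : 2^-1 <= ln 2 :> R.
Proof.
rewrite -[leLHS]expRK ler_ln ?posrE ?expR_gt0//.
have h := expR_ge1Dx (- 2^-1 : R).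
rewrite -[leRHS]invrK -[leLHS]invrK lef_pV2 ?posrE ?invr_gt0 ?expR_gt0// -expRN.
lra.
Qed.

(** The linear lower bound as x tends to 0 is what turns the sum of the weights
into 1 / (2 s - 1). *)
Lemma one_sub_powR_half (R : realType) (x : R) : 0 < x < 1 ->
  x / 3 <= 1 - 2^-1 `^ x.
Proof.
move=> /andP[x0 x1].
have h : 1 + x / 2 <= 2 `^ x.
  rewrite /powR pnatr_eq0/=; apply: le_trans (expR_ge1Dx _).
  by rewrite lerD2l ler_pM2l//; exact: ln2_ge_half.
have -> : 2^-1 `^ x = (2 `^ x)^-1 by rewrite -powR_inv1// -powRrM mulN1r powRN.
have : (2 `^ x)^-1 <= (1 + x / 2)^-1 by rewrite lef_pV2 ?posrE//; lra.
suff : (1 + x / 2)^-1 <= 1 - x / 3 by lra.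
by rewrite -[leLHS]mul1r ler_pdivrMr; nra.
Qed.

Lemma sum_powR_half (R : realType) (x : R) n : 0 < x < 1 ->
  \sum_(m < n) (2 ^- m) `^ x <= 3 / x.
Proof.
move=> x01; have := one_sub_powR_half x01; have /andP[x0 x1] := x01.
set q := 2^-1 `^ x => q1.
have q0 : 0 <= q by rewrite powR_ge0.
have -> : \sum_(m < n) (2 ^- m) `^ x = \sum_(m < n) q ^+ m.
  apply: eq_bigr => m _.
  rewrite -exprVn -[in LHS]powR_mulrn ?invr_ge0// -powRrM mulrC powRrM.
  by rewrite powR_mulrn ?powR_ge0.
have -> : \sum_(m < n) q ^+ m = (1 - q ^+ n) / (1 - q).
  apply: (@mulIf _ (1 - q)); first by rewrite gt_eqF; lra.
  rewrite divfK; last by rewrite gt_eqF; lra.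
  elim: n => [|n IH]; first by rewrite big_ord0 mul0r expr0 subrr.
  by rewrite big_ord_recr/= mulrDl IH exprS; ring.
have qn : 0 <= q ^+ n by rewrite exprn_ge0.
rewrite ler_pdivrMr; last lra.
rewrite mulrAC ler_pdivlMr//; nra.
Qed.

Section zero_on_line.
Variables (R : realType) (u : R * R -> R) (a z b l : R).
Hypothesis mu : measurable_fun [set: measurableTypeR R * measurableTypeR R] u.
Hypothesis l0 : 0 < l.

Let mean n := (((l / 2 ^+ n)^-1)%:E *
  \int[@lebesgue_measure R]_(t in halving_itv z b l n) (u (a, t) ^+ 2)%:E)%E.

Let osc n := (\int[@lebesgue_measure R]_(t in halving_itv z b l n)
       \int[@lebesgue_measure2 R]_(w in halving_box a z b l n)
         ((u (a, t) - u w) ^+ 2)%:E)%E.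

Let mean_ge0 n : (0 <= mean n)%E.
Proof.
rewrite mule_ge0//; first by rewrite lee_fin invr_ge0 divr_ge0 ?ltW// exprn_ge0.
by apply: integral_ge0 => t _; rewrite lee_fin sqr_ge0.
Qed.

Let osc_ge0 n : (0 <= osc n)%E.
Proof.
by do 2 (apply: integral_ge0 => ? _); rewrite lee_fin sqr_ge0.
Qed.

(** Passing from the n-th interval to the next through the n-th box, by two
applications of [integral_sq_pair]; both differences are controlled by the
oscillation between the n-th interval and the n-th box. *)
Let mean_step n (tau th : R) : 0 < tau -> 0 < th ->
  (mean n <= (tau + 2 * th)%:E *
    ((3 / th * (l / 2 ^+ n) ^- 3)%:E * osc n + (tau^-1)%:E * mean n.+1))%E.
Proof.
move=> tau0 th0; rewrite /mean.
have L0 : 0 < l / 2 ^+ n by rewrite divr_gt0// exprn_gt0.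
have eL : l / 2 ^+ n.+1 = (l / 2 ^+ n) / 2 by rewrite (half_dyadic l n); field;
  rewrite expf_neq0.
rewrite eL; move: eL L0; set L := l / 2 ^+ n => eL L0.
set x := (\int[_]_(t in halving_itv z b l n) _)%E.
set w := (\int[_]_(t in halving_itv z b l n.+1) _)%E.
have x0 : (0 <= x)%E by apply: integral_ge0 => t _; rewrite lee_fin sqr_ge0.
have w0 : (0 <= w)%E by apply: integral_ge0 => t _; rewrite lee_fin sqr_ge0.
have mB := measurable_halving_box a z b l n.
have mua : measurable_fun setT (fun t : measurableTypeR R => u (a, t)).
  exact: measurable_fun_pair2.
have lJ : (@lebesgue_measure R (halving_itv z b l n) = L%:E)%E.
  exact: lebesgue_measure_itvco.
have lJ' : (@lebesgue_measure R (halving_itv z b l n.+1) = (L / 2)%:E)%E.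
  by rewrite -eL; apply: lebesgue_measure_itvco; rewrite eL; lra.
have lB : (@lebesgue_measure2 R (halving_box a z b l n) = (L * L)%:E)%E.
  rewrite /halving_box lebesgue_measure2X//; last exact: measurable_halving_itv.
  by rewrite lJ -/L (lebesgue_measure_itvco a L0) EFinM.
set y := (\int[@lebesgue_measure2 R]_(w in halving_box a z b l n) (u w ^+
  2)%:E)%E.
pose i' := (\int[@lebesgue_measure2 R]_(w in halving_box a z b l n)
  \int[@lebesgue_measure R]_(t in halving_itv z b l n.+1) ((u w - u (a, t)) ^+
    2)%:E)%E.
have xy : ((L * L)%:E * x <= ((th + (tau + th)) / th)%:E * osc n +
    ((th + (tau + th)) / (tau + th))%:E * (L%:E * y))%E.
  rewrite -lB -lJ; apply: (@integral_sq_pair _ _ _ _ R lebesgue_measure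
    (@lebesgue_measure2 R)) => //.
    exact: measurable_halving_itv.
  exact: addr_gt0.
have yw : ((L / 2)%:E * y <= ((th + tau) / th)%:E * i' +
    ((th + tau) / tau)%:E * ((L * L)%:E * w))%E.
  rewrite -lB -lJ'; apply: (@integral_sq_pair _ _ _ _ R (@lebesgue_measure2 R)
    lebesgue_measure) => //.
  exact: measurable_halving_itv.
have i'i : (i' <= osc n)%E.
  have mh : measurable_fun setT (fun z :
    (measurableTypeR R * measurableTypeR R) * measurableTypeR R =>
      ((u z.1 - u (a, z.2)) ^+ 2)%:E).
    apply/measurable_EFinP/measurable_funX/measurable_funB.
      by apply: measurableT_comp => //; exact: measurable_fst.
    by apply: (measurableT_comp mua); exact: measurable_snd.
  rewrite /i' (@tonelli_swap _ _ _ _ R (@lebesgue_measure2 R) lebesgue_measure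
    (fun z => ((u z.1 - u (a, z.2)) ^+ 2)%:E))//; first last.
  - by move=> ?; rewrite lee_fin sqr_ge0.
  - exact: measurable_itv.
  rewrite (_ : (\int[_]_(x in _) _)%E =
     (\int[@lebesgue_measure R]_(t in halving_itv z b l n.+1)
       \int[@lebesgue_measure2 R]_(w in halving_box a z b l n)
         ((u (a, t) - u w) ^+ 2)%:E)%E); last first.
    by apply: eq_integral => t _; apply: eq_integral => s _;
      rewrite -sqrrN opprB.
  apply: ge0_subset_integral.
  - exact: measurable_itv.
  - exact: measurable_itv.
  - apply: measurable_funTS; apply: (@measurable_integral_section _ _ _ _ R
      (@lebesgue_measure2 R) (fun z => ((u (a, z.1) - u z.2) ^+ 2)%:E)) => //.
      apply/measurable_EFinP; exact: measurable_sqdiff_line.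
    by move=> ?; rewrite lee_fin sqr_ge0.
  - by move=> t _; apply: integral_ge0 => ? _; rewrite lee_fin sqr_ge0.
  - by move=> t /halving_itvS; apply.
move: (osc_ge0 n) i'i xy; move: (osc n) => i i0 i'i xy.
have LLL : 0 < L ^- 3 by rewrite invr_gt0 exprn_gt0.
have -> : (L^-1%:E * x = (L ^- 3)%:E * ((L * L)%:E * x))%E.
  by rewrite muleA -EFinM; congr (_%:E * _)%E; field; rewrite gt_eqF.
have yE : (L%:E * y = 2%:E * ((L / 2)%:E * y))%E.
  by rewrite muleA -EFinM; congr (_%:E * _)%E; field.
have {}yw : ((L / 2)%:E * y <= ((th + tau) / th)%:E * i +
    ((th + tau) / tau)%:E * ((L * L)%:E * w))%E.
  by apply: (le_trans yw); rewrite leeD2r// lee_wpmul2l// lee_fin divr_ge0; lra.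
apply: (@le_trans _ _ ((L ^- 3)%:E * (((th + (tau + th)) / th)%:E * i +
    ((th + (tau + th)) / (tau + th))%:E * (2%:E * (((th + tau) / th)%:E * i +
    ((th + tau) / tau)%:E * ((L * L)%:E * w)))))%E).
  apply: lee_wpmul2l; first by rewrite lee_fin ltW.
  apply: (le_trans xy); apply: leeD => //; apply: lee_wpmul2l.
    by rewrite lee_fin divr_ge0; lra.
  by rewrite yE; apply: lee_wpmul2l.
rewrite le_eqVlt; apply/orP; left; apply/eqP.
have ge (r : R) (e : \bar R) : 0 <= r -> (0 <= e)%E -> (0 <= r%:E * e)%E.
  by move=> r0 e0; rewrite mule_ge0.
clearbody w; rewrite !(ge0_muleDr, muleA, =^~ EFinM, ge)//.
rewrite addeA -ge0_muleDl ?lee_fin//; first last.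
- by rewrite ltW// !(mulr_gt0, invr_gt0, addr_gt0, exprn_gt0).
- by rewrite ltW// !(mulr_gt0, invr_gt0, addr_gt0, exprn_gt0).
rewrite -EFinD; congr (_%:E * _ + _%:E * _)%E; field;
  by rewrite ?gt_eqF// addr_gt0.
all: try by rewrite ltW// !(mulr_gt0, invr_gt0, addr_gt0, exprn_gt0).
by apply: adde_ge0; apply: ge => //;
  rewrite ltW// !(mulr_gt0, invr_gt0, addr_gt0, exprn_gt0).
Qed.

(** Weighted Cauchy-Schwarz along the chain.  Leaving tau free makes the
induction close: the step is applied with tau, the induction hypothesis with
tau + 2 th n. *)
Let mean_chain (th : nat -> R) n (tau : R) : (forall m, 0 < th m) -> 0 < tau ->
  (mean 0 <= (tau + 2 * \sum_(m < n) th m)%:E *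
    (\sum_(m < n) (3 / th m * (l / 2 ^+ m) ^- 3)%:E * osc m +
     (tau^-1)%:E * mean n))%E.
Proof.
move=> th0; elim: n tau => [|n IH] tau tau0.
  rewrite !big_ord0 mulr0 addr0 add0e muleA -EFinM mulfV ?gt_eqF//.
  by rewrite mul1e.
have tau'0 : 0 < tau + 2 * th n by have := th0 n; lra.
apply: (le_trans (IH _ tau'0)).
have -> : tau + 2 * th n + 2 * (\sum_(m < n) th m) =
  tau + 2 * (\sum_(m < n.+1) th m) by rewrite big_ord_recr/=; ring.
have S0 : 0 <= \sum_(m < n.+1) th m by apply: sumr_ge0 => m _; exact: ltW.
apply: lee_wpmul2l; first by rewrite lee_fin; lra.
rewrite [in leRHS]big_ord_recr/= -addeA; apply: leeD => //.
have tauV0 : (0 <= ((tau + 2 * th n)^-1)%:E)%E by rewrite lee_fin invr_ge0 ltW.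
apply: le_trans (lee_wpmul2l tauV0 (mean_step n tau0 (th0 n))) _.
by rewrite muleA -EFinM mulVf ?mul1e// lt0r_neq0.
Qed.

Let mean_small (e : R) : continuous u -> u (a, z) = 0 -> b <= z < b + l ->
  0 < e -> exists n, (mean n <= e%:E)%E.
Proof.
move=> cu uz zb e0.
have se0 : 0 < Num.sqrt e by rewrite sqrtr_gt0.
have [d /= d0 zd] : exists2 d : R, 0 < d &
    forall t, `|t - z| < d -> `|u (a, t)| < Num.sqrt e.
  have /cvgrPdist_lt/(_ _ se0)/(@nbhs_ballP R)[d /= d0 H] := cu (a, z).
  exists d => // t tz; have := H (a, t); rewrite uz sub0r normrN; apply.
  by split => /=; [exact: ballxx|rewrite /ball/= distrC].
have [n nd] : exists n, l / 2 ^+ n < d.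
  exists (Num.bound (l / d));
    rewrite ltr_pdivrMr ?exprn_gt0// mulrC -ltr_pdivrMr//.
  apply: (lt_le_trans (archi_boundP (ltW (divr_gt0 l0 d0)))).
  by rewrite -natrX ler_nat ltnW// ltn_expl.
exists n; have L0 : 0 < l / 2 ^+ n by rewrite divr_gt0// exprn_gt0.
have lJ : (@lebesgue_measure R (halving_itv z b l n) = (l / 2 ^+ n)%:E)%E.
  exact: lebesgue_measure_itvco.
rewrite /mean muleC lee_pdivrMr//.
apply: (@le_trans _ _ (\int[@lebesgue_measure R]_(t in halving_itv z b l n)
  (cst e%:E t))%E).
  apply: ge0_le_integral => //.
  - exact: measurable_itv.
  - by move=> t _; rewrite lee_fin sqr_ge0.
  - apply/measurable_EFinP/measurable_funX/measurable_funTS.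
    exact: measurable_fun_pair2.
  move=> t; rewrite /halving_itv/= in_itv/= => /andP[t1 t2].
  have /andP[z1 z2] := halving_mem n zb.
  have /ltW : `|u (a, t)| < Num.sqrt e.
    by apply: zd; apply: lt_trans nd; rewrite ltr_norml; lra.
  rewrite lee_fin => ute.
  by rewrite -(real_normK (num_real _)) -(sqr_sqrtr (ltW e0)) ler_sqr// nnegrE
    ltW.
rewrite integral_cst; last exact: measurable_itv.
by rewrite -lJ.
Qed.

(** As u vanishes at z the last mean of the chain tends to 0, and the weights
2^(-m (2 s - 1)) balance the oscillations against the kernel of exponent
2 + 2 s. *)
Lemma integral_sq_zero_on_line (s : R) :
  continuous u -> u (a, z) = 0 -> b <= z < b + l -> 2^-1 < s < 1 ->
  (\int[@lebesgue_measure R]_(t in `[b, (b + l)%R[) (u (a, t) ^+ 2)%:E <=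
   (54 / (2 * s - 1) * l `^ (2 * s))%:E *
   \int[@lebesgue_measure R]_(t in `[b, (b + l)%R[)
     energy u (2 + 2 * s) l (a, t))%E.
Proof.
move=> cu uz zb /andP[s2 s1].
set I := (\int[_]_(t in _) energy _ _ _ _)%E.
have I0 : (0 <= I)%E by apply: integral_ge0 => t _; exact: energy_ge0.
have x01 : 0 < 2 * s - 1 < 1 by lra.
have sx : 2 * s = 2 * s - 1 + 1 by ring.
have px : 2 + 2 * s = 2 * s - 1 + 3%:R by ring.
move: x01 sx px; move: (2 * s - 1) => x x01 sx px.
have /andP[x0 x1] := x01.
pose th m : R := (2 ^- m) `^ x.
have th0 m : 0 < th m by rewrite powR_gt0// invr_gt0 exprn_gt0.
have c0 : 0 <= 3 * l `^ x by rewrite mulr_ge0 ?powR_ge0.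
have mean0 : (mean 0 <= (9 / x)%:E * ((6 * l `^ x)%:E * I))%E.
  (* The last mean is made smaller than e over the total weight 9 / x. *)
  apply/lee_addgt0Pr => e e0.
  have K0 : 0 < 9 / x by rewrite divr_gt0.
  have eE : 9 / x * (e / (9 / x)) = e by rewrite mulrCA mulfV ?mulr1// gt_eqF.
  have [n small] := mean_small cu uz zb (divr_gt0 e0 K0).
  apply: (le_trans (mean_chain n th0 ltr01)).
  apply: (@le_trans _ _ ((9 / x)%:E * ((6 * l `^ x)%:E * I + (e / (9 /
    x))%:E))%E); last first.
    rewrite ge0_muleDr//; last 2 first.
    - by rewrite mule_ge0// lee_fin mulr_ge0 ?powR_ge0.
    - by rewrite lee_fin divr_ge0// ltW.
    by rewrite -(EFinM (9 / x)) eE.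
  have S0 : (0 <= \sum_(m < n) (3 / th m * (l / 2 ^+ m) ^- 3)%:E * osc m)%E.
    apply: sume_ge0 => m _; apply: mule_ge0; last exact: osc_ge0.
    have L0 : 0 < l / 2 ^+ m by rewrite divr_gt0// exprn_gt0.
    by rewrite lee_fin ltW// divr_gt0 ?exprn_gt0// divr_gt0.
  apply: lee_pmul.
  - by rewrite lee_fin addr_ge0// mulr_ge0// sumr_ge0// => m _; exact: ltW.
  - by rewrite adde_ge0// mule_ge0// lee_fin invr1.
  - rewrite lee_fin; have := sum_powR_half n x01.
    have : 1 <= 3 / x by rewrite ler_pdivlMr; lra.
    by rewrite -/(th _); rewrite /th; lra.
  apply: leeD; last by rewrite invr1 mul1e.
  apply: (@le_trans _ _ ((3 * l `^ x)%:E * (2%:E * I))%E); last first.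
    by rewrite muleA -EFinM lee_wpmul2r// lee_fin; lra.
  have p1 : 1 <= 2 + 2 * s by lra.
  apply: le_trans (lee_wpmul2l _ (sum_dyadic_pairs a z b n mu l0 p1));
    last by rewrite lee_fin.
  rewrite ge0_sume_distrr; last first.
    move=> m _; apply: mule_ge0; last exact: osc_ge0.
    by rewrite lee_fin powR_ge0.
  apply: lee_sum => m _; rewrite [leRHS]muleA -EFinM -/(osc m).
  apply: lee_wpmul2r; first exact: osc_ge0.
  rewrite lee_fin le_eqVlt; apply/orP; left; apply/eqP.
  have L0 : 0 < l / 2 ^+ m by rewrite divr_gt0// exprn_gt0.
  have eL : (l / 2 ^+ m) `^ x = l `^ x * th m.
    by rewrite /th -powRM// ?ltW// invr_ge0 exprn_ge0.
  rewrite px.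
  rewrite powRN powRD ?(gt_eqF L0) ?implybT// powR_mulrn ?ltW// eL.
  have := powR_gt0 x l0; have := th0 m.
  move: (l `^ x) (th m) => lx t t0 lx0.
  by field; rewrite !gt_eqF//= exprn_gt0.
have h0 : halving_itv z b l 0 = `[b, (b + l)%R[%classic.
  by rewrite /halving_itv/= expr0 divr1.
move: mean0; rewrite /mean h0 expr0 divr1 => mean0.
have l00 : (0 <= l%:E)%E by rewrite lee_fin ltW.
have := lee_wpmul2l l00 mean0.
rewrite muleA -EFinM mulfV ?gt_eqF// mul1e => /le_trans; apply.
rewrite !muleA -!EFinM lee_wpmul2r// lee_fin.
rewrite sx powRD ?(gt_eqF l0) ?implybT// powRr1 ?(ltW l0)//.
by rewrite le_eqVlt; apply/orP; left; apply/eqP; field; rewrite gt_eqF.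
Qed.

End zero_on_line.

(** * Components of the complement *)

(** Otherwise the open square and the complement of the closed one would
disconnect the component.  The argument takes place in the sphere: the
component may well go through the point at infinity, which lies outside the
compact closed square. *)
Lemma component_meets_square (R : realType) (Omega : set (R * R))
    (p p' : R * R) (rho : R) :
  let A := ~` (Some @` Omega : set (one_point_compactification (R * R)%type)) in
  ~ Omega p -> connected_component A (Some p) (Some p') ->
  0 < rho < `|p' - p| -> exists2 y, ~ Omega y & `|y - p| = rho.
Proof.
move=> A Op Kp' /andP[rho0 rhop].
have Ap : A (Some p) by move=> [y Oy [yp]]; apply: Op; rewrite -yp.
set K := connected_component A (Some p) in Kp' *.
have Kp : K (Some p) by exact: connected_component_refl.
apply: contrapT => nex.
have Kne y : K (Some y) -> `|y - p| != rho.
  move=> Ky; apply/eqP => yrho; apply: nex; exists y => // Oy.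
  have : A (Some y) by exact: (@connected_component_sub _ A (Some p)).
  by apply; exists y.
pose U : set (R * R) := [set y | `|y - p| < rho].
pose C : set (R * R) := [set y | `|y - p| <= rho].
have cdist : continuous (fun y : R * R => `|y - p|).
  by move=> y; apply: cvg_norm; apply: cvgB; [exact: cvg_id|exact: cvg_cst].
have oU : open U by exact: (@open_comp _ _ (fun y :
  R * R => `|y - p|) [set r | r < rho]).
have oC : open (~` C).
  have -> : ~` C = [set y | rho < `|y - p|].
    by apply/seteqP; split => y /=; rewrite /C/= ltNge => /negP.
  exact: (@open_comp _ _ (fun y : R * R => `|y - p|) [set r | rho < r]).
have cC : compact C.
  have -> : C = `[p.1 - rho, p.1 + rho]%classic `*` `[p.2 - rho, p.2 +
    rho]%classic.
    apply/seteqP; split => y /=;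
      rewrite /C/= prod_norm_le/= !in_itv/= !ler_norml.
      by move=> /andP[/andP[? ?] /andP[? ?]]; split; lra.
    by move=> [/andP[? ?] /andP[? ?]]; lra.
  by apply: compact_setX; exact: segment_compact.
(* The trace of the open square on K is also the trace of the closed one. *)
have KUE : K `&` Some @` U = K.
  apply: (@component_connected _ A (Some p)).
  - by exists (Some p); split => //; exists p => //; rewrite /U/= subrr normr0.
  - by exists (Some @` U) => //; exact: one_point_compactification_open_some.
  exists (Some @` C : set (one_point_compactification (R * R)%type)).
    rewrite -openC openE => -[y|] /= ny.
      have {}ny : (~` C) y by move=> Cy; apply: ny; exists y.
      have := @one_point_compactification_some_nbhs _ y _ (open_nbhs_nbhs (conj
        oC ny)).
      by apply: filterS => _ [x nCx <-] [x' Cx' [xx']]; apply: nCx;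
        rewrite -xx'.
    exists C; first by split => //; rewrite -openC.
    by move=> _ [[x nCx <-] [x' Cx' [xx']]|-> [x' _ //]]; apply: nCx;
      rewrite -xx'.
  apply/seteqP; split => x [Kx [y /= Uy yx]]; split => //; exists y => //.
    exact: ltW.
  by rewrite /U /= lt_neqAle (Kne y) ?yx//.
have : (K `&` Some @` U) (Some p') by rewrite KUE.
by move=> [_ [y /= yU [yp']]]; move: yU; rewrite yp' /U/=; lra.
Qed.

(** Mapping an index to the component of its chosen point is injective on the
indices whose component contains no other chosen point, so there are at most k
of these.  For any other index the component reaches the point chosen for a
second index, at distance more than 6 rho - 2 rho from the first one. *)
Lemma many_cells_crossed (R : realType) (Omega : set (R * R)) (k : nat)
    (T : finType) (c : T -> R * R) (rho : R) :
  multiply_connected k Omega ->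
  (forall x, exists2 p, ~ Omega p & `|p - x| < rho) ->
  (forall i j, i != j -> 6 * rho <= `|c i - c j|) ->
  exists G : {set T}, (#|T| <= k + #|G|)%N /\
    forall i, i \in G -> exists2 p, `|p - c i| < rho &
      forall r, 0 < r < 2 * rho -> exists2 y, ~ Omega y & `|y - p| = r.
Proof.
move=> [_ /card_set_bijP[f [fk finj _]]] hit far.
have /choice[p Hp] : forall i : T, exists p, ~ Omega p /\ `|p - c i| < rho.
  by move=> i; have [q] := hit (c i); exists q.
set A := ~` _ in f fk finj.
pose comp i := connected_component A (Some (p i)).
have Ap i : A (Some (p i)).
  by move=> [y Oy [yp]]; have [nO _] := Hp i; apply: nO; rewrite -yp.
have compP i : components A (comp i) by exists (Some (p i)).
pose G : {set T} := [set i | [exists j, (j != i) && `[< comp i =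
  comp j >]]]%SET.
exists G; split.
  have fI i : (f (comp i) < k)%N by exact: fk.
  pose g i : 'I_k := Ordinal (fI i).
  have ginj : {in ~: G &, injective g}.
    move=> i j; rewrite !inE => Gi _ /(congr1 val)/= fij; apply/eqP.
    apply: contraNT Gi => ij; apply/existsP; exists j; rewrite eq_sym ij/=.
    by apply/asboolP; apply: finj fij; rewrite inE.
  rewrite -(cardsC G) addnC leq_add2r -[leqRHS]card_ord.
  exact: leq_card_in ginj.
move=> i; rewrite inE => /existsP[j /andP[ji /asboolP cij]].
have [nOi pi] := Hp i; have [nOj pj] := Hp j.
exists (p i) => // r /andP[r0 r2].
apply: (@component_meets_square _ _ _ (p j)) => //.
  change (comp i (Some (p j))); rewrite cij.
  exact: connected_component_refl.
rewrite r0/=; have := far _ _ ji.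
have : `|c j - c i| <= `|p j - c j| + `|p j - p i| + `|p i - c i|.
  have -> : c j - c i = - (p j - c j) + (p j - p i) + (p i - c i).
    by rewrite opprB !addrA !subrK.
  by apply: (le_trans (ler_normD _ _));
    rewrite lerD2r (le_trans (ler_normD _ _))// normrN.
by lra.
Qed.

(** * Cells crossed by the complement *)

Lemma integral2_tonelli (R : realType)
    (f : measurableTypeR R * measurableTypeR R -> \bar R) :
  measurable_fun setT f -> (forall z, 0 <= f z)%E ->
  (\int[@lebesgue_measure2 R]_z f z =
   \int[@lebesgue_measure R]_x \int[@lebesgue_measure R]_y f (x, y))%E.
Proof. by move=> mf f0; rewrite /lebesgue_measure2 fubini_tonelli1. Qed.

Lemma integral2_swap (R : realType)
    (f : measurableTypeR R * measurableTypeR R -> \bar R) :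
  measurable_fun setT f -> (forall z, 0 <= f z)%E ->
  (\int[@lebesgue_measure2 R]_z f (z.2, z.1) =
    \int[@lebesgue_measure2 R]_z f z)%E.
Proof.
move=> mf f0.
have mfs : measurable_fun setT (fun z :
  measurableTypeR R * measurableTypeR R => f (z.2, z.1)).
  apply: (measurableT_comp mf (g := fun z => (z.2, z.1))).
  by apply: measurable_fun_pair; [exact: measurable_snd|exact: measurable_fst].
rewrite (integral2_tonelli mfs (fun z => f0 _)) (integral2_tonelli mf f0)/=.
by rewrite [RHS](@fubini_tonelli _ _ _ _ R lebesgue_measure lebesgue_measure f).
Qed.

Lemma energy_swap (R : realType) (u : R * R -> R) p d (x : R * R) :
  measurable_fun [set: measurableTypeR R * measurableTypeR R] u ->
  energy (fun z => u (z.2, z.1)) p d (x.2, x.1) = energy u p d x.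
Proof.
move=> mu; rewrite /energy -[RHS]integral2_swap.
- apply: eq_integral => y _; rewrite /energy_density/=.
  by rewrite -surjective_pairing !prod_normE/= maxC.
- apply/measurable_EFinP.
  exact: (measurableT_comp (measurable_energy_density p d mu)).
- by move=> z; rewrite lee_fin energy_density_ge0.
Qed.

Lemma integral_sq_zero_on_hline (R : realType) (u : R * R -> R) (a z b l s :
  R) :
  continuous u -> 0 < l -> u (z, a) = 0 -> b <= z < b + l -> 2^-1 < s < 1 ->
  (\int[@lebesgue_measure R]_(t in `[b, (b + l)%R[) (u (t, a) ^+ 2)%:E <=
   (54 / (2 * s - 1) * l `^ (2 * s))%:E *
   \int[@lebesgue_measure R]_(t in `[b, (b + l)%R[)
     energy u (2 + 2 * s) l (t, a))%E.
Proof.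
move=> cu l0 uz zb s01; have mu := continuous_measurable2 cu.
pose v (x : R * R) := u (x.2, x.1).
have cv : continuous v.
  move=> x; apply: (@continuous_comp _ _ _ (fun x => (x.2, x.1)) u).
    exact: swap_continuous.
  exact: cu.
have mv := continuous_measurable2 cv.
have eS t : energy v (2 + 2 * s) l (a, t) = energy u (2 + 2 * s) l (t, a).
  exact: (energy_swap (2 + 2 * s) l (t, a) mu).
have := @integral_sq_zero_on_line _ v a z b l mv l0 s cv uz zb s01.
by under [X in (_ <= _ * X)%E -> _]eq_integral do rewrite eS.
Qed.

Lemma le_integral_affine_itv (R : realType) (V : measurableTypeR R -> \bar R)
    (a b tau : R) (I : set (measurableTypeR R)) :
  `|a| = 1 -> measurable_fun setT V -> (forall x, 0 <= V x)%E -> measurable I ->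
  (forall r, 0 < r < tau -> I (a * r + b)) ->
  (\int[@lebesgue_measure R]_(r in `]0%R, tau[) V (a * r + b)%R <=
   \int[@lebesgue_measure R]_(x in I) V x)%E.
Proof.
move=> a1 mV V0 mI inI.
have a0 : a != 0 by rewrite -normr_gt0 a1.
have mVI : measurable_fun setT (V \_ I).
  exact: (measurable_restrictT V mI).1 (measurable_funTS mV).
have VI0 x : (0 <= (V \_ I) x)%E by apply: erestrict_ge0.
have -> : (\int[@lebesgue_measure R]_(x in I) V x =
    \int[@lebesgue_measure R]_x (V \_ I) (a * x + b)%R)%E.
  by rewrite ge0_integral_affine// a1 invr1 mul1e integral_mkcond.
have maff : measurable_fun setT (fun r : measurableTypeR R => a * r + b :
  measurableTypeR R).
  by apply: measurable_funD => //; exact: measurable_funM.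
rewrite [leLHS]integral_mkcond; apply: ge0_le_integral => //.
- by move=> x _; apply: erestrict_ge0 => ? _; exact: V0.
- apply/(measurable_restrictT _ _).1 => //.
  by apply: measurable_funTS; exact: (measurableT_comp mV).
- exact: (measurableT_comp mVI).
move=> r _; rewrite {1}/patch; case: ifPn => // rI.
rewrite /patch ifT// inE; apply: inI.
by move: rI; rewrite inE/= in_itv.
Qed.

(** Integrate over r the sum of the integrals of H over the four lines at
distance r from p: the sum dominates e without having to say measurably which
line is the good one, and each of the four terms is part of the integral of H
over the rectangle. *)
Lemma integral_over_squares (R : realType)
    (H : measurableTypeR R * measurableTypeR R -> \bar R) (e : \bar R)
    (I J : set (measurableTypeR R)) (p : R * R) (tau : R) :
  measurable_fun setT H -> (forall z, 0 <= H z)%E -> (0 <= e)%E -> 0 < tau ->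
  measurable I -> measurable J ->
  (forall r, `|r| < tau -> I (p.1 + r) /\ J (p.2 + r)) ->
  (forall r, 0 < r < tau -> exists2 y : R * R, `|y - p| = r &
     (e <= \int[@lebesgue_measure R]_(t in J) H (y.1, t))%E /\
     (e <= \int[@lebesgue_measure R]_(t in I) H (t, y.2))%E) ->
  (tau%:E * e <= 4%:E * \int[@lebesgue_measure2 R]_(z in I `*` J) H z)%E.
Proof.
move=> mH H0 e0 tau0 mI mJ inIJ cross.
pose V x := (\int[@lebesgue_measure R]_(t in J) H (x, t))%E.
pose W x := (\int[@lebesgue_measure R]_(t in I) H (t, x))%E.
have V0 x : (0 <= V x)%E by apply: integral_ge0.
have W0 x : (0 <= W x)%E by apply: integral_ge0.
have mV : measurable_fun setT V by exact: measurable_integral_section.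
have mHs : measurable_fun setT (fun z :
  measurableTypeR R * measurableTypeR R => H (z.2, z.1)).
  apply: (measurableT_comp mH (g := fun z => (z.2, z.1))).
  by apply: measurable_fun_pair; [exact: measurable_snd|exact: measurable_fst].
have mW : measurable_fun setT W.
  by apply: (@measurable_integral_section _ _ _ _ R lebesgue_measure
    (fun z => H (z.2, z.1))).
set S := (\int[_]_(z in _) H z)%E.
have VS : (\int[@lebesgue_measure R]_(x in I) V x = S)%E.
  exact: (@tonelli_rectangle _ _ _ _ R lebesgue_measure lebesgue_measure H).
have WS : (\int[@lebesgue_measure R]_(x in J) W x = S)%E.
  by rewrite -VS [RHS](@tonelli_swap _ _ _ _ R lebesgue_measure
    lebesgue_measure H).
have sub a (b : R) (F : measurableTypeR R -> \bar R) (D :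
  set (measurableTypeR R)) :
    `|a| = 1 -> measurable_fun setT F -> (forall x, 0 <= F x)%E ->
      measurable D ->
    (forall r, `|r| < tau -> D (b + r)) ->
    (\int[@lebesgue_measure R]_(r in `]0%R, tau[) F (a * r + b)%R <=
     \int[@lebesgue_measure R]_(x in D) F x)%E.
  move=> a1 mF F0 mD inD; apply: le_integral_affine_itv => // r /andP[r0 rt].
  by rewrite addrC; apply: inD; rewrite normrM a1 mul1r gtr0_norm.
have pos a (b : R) (F : measurableTypeR R -> \bar R) : measurable_fun setT F ->
    measurable_fun setT (fun r : measurableTypeR R => F (a * r + b)%R).
  move=> mF; apply: (measurableT_comp mF (g := fun r => a * r + b)).
  by apply: measurable_funD => //; exact: measurable_funM.
have m1 : `|1 : R| = 1 by rewrite normr1.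
have m2 : `|- 1 : R| = 1 by rewrite normrN1.
have lt : (@lebesgue_measure R `]0%R, tau[ = tau%:E)%E.
  by rewrite lebesgue_measure_itv/= lte_fin tau0 -EFinB subr0.
apply: (@le_trans _ _ (\int[@lebesgue_measure R]_(r in `]0%R, tau[)
   ((V (1 * r + p.1)%R + V (-1 * r + p.1)%R) + (W (1 * r + p.2)%R + W (-1 * r +
     p.2)%R)))%E).
  rewrite -lt muleC -integral_cst; last exact: measurable_itv.
  apply: ge0_le_integral => //.
  - by apply: measurable_funTS; do 2 apply: emeasurable_funD; exact: pos.
  move=> r /=; rewrite in_itv/= => rt.
  have [y yp [eV eW]] := cross r rt.
  have /andP[r0 _] := rt.
  have vge0 : (0 <= V (1 * r + p.1)%R + V (-1 * r + p.1)%R)%E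
    by exact: adde_ge0.
  have wge0 : (0 <= W (1 * r + p.2)%R + W (-1 * r + p.2)%R)%E
    by exact: adde_ge0.
  (* A point of the boundary lies on one of the lines at signed distance r. *)
  have signed (t q : R) : `|t - q| = r -> t = 1 * r + q \/ t = -1 * r + q.
    rewrite mul1r mulN1r => <-; have [h|h] := leP 0 (t - q).
      by left; rewrite ger0_norm// subrK.
    by right; rewrite ltr0_norm// opprK subrK.
  have : `|y.2 - p.2| = r \/ `|y.1 - p.1| = r.
    by move: yp; rewrite prod_normE /Num.max; case: ifP => _; [left|right].
  case=> /signed => -[] yE.
  - apply: (le_trans eW); rewrite -/(W _) yE;
      apply: (@le_trans _ _ (W (1 * r + p.2)%R + W (-1 * r + p.2)%R)%E).
      exact: leeDl.
    exact: leeDr.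
  - apply: (le_trans eW); rewrite -/(W _) yE;
      apply: (@le_trans _ _ (W (1 * r + p.2)%R + W (-1 * r + p.2)%R)%E).
      exact: leeDr.
    exact: leeDr.
  - apply: (le_trans eV); rewrite -/(V _) yE;
      apply: (@le_trans _ _ (V (1 * r + p.1)%R + V (-1 * r + p.1)%R)%E).
      exact: leeDl.
    exact: leeDl.
  - apply: (le_trans eV); rewrite -/(V _) yE;
      apply: (@le_trans _ _ (V (1 * r + p.1)%R + V (-1 * r + p.1)%R)%E).
      exact: leeDr.
    exact: leeDl.
have S0 : (0 <= S)%E by apply: integral_ge0.
clearbody V W S; rewrite !ge0_integralD//; try (by move=> ? _; exact: adde_ge0);
  try (by apply: measurable_funTS; exact: pos);
  try (by apply: measurable_funTS; apply: emeasurable_funD; exact: pos).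
have -> : (4%:E * S = (S + S) + (S + S))%E.
  have -> : 4 = (1 + 1) + (1 + 1) :> R by ring.
  by rewrite !EFinD !ge0_muleDl ?adde_ge0// mul1e.
apply: leeD; apply: leeD.
- by rewrite -VS; exact: (sub 1 p.1 V I m1 mV V0 mI (fun r h => (inIJ r h).1)).
- by rewrite -VS; exact: (sub (-1) p.1 V I m2 mV V0 mI (fun r h => (inIJ r
    h).1)).
- by rewrite -WS; exact: (sub 1 p.2 W J m1 mW W0 mJ (fun r h => (inIJ r h).2)).
- by rewrite -WS; exact: (sub (-1) p.2 W J m2 mW W0 mJ (fun r h => (inIJ r
    h).2)).
Qed.

(** Half-open squares tile the plane exactly. *)
Definition square (R : realType) (b : R * R) (a : R) :
    set (measurableTypeR R * measurableTypeR R) :=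
  `[b.1, b.1 + a[%classic `*` `[b.2, b.2 + a[%classic.

Lemma measurable_square (R : realType) (b : R * R) (a : R) :
  measurable (square b a).
Proof. by apply: measurableX; exact: measurable_itv. Qed.

Lemma measurable_integral_sqdiff (R : realType) (u : R * R -> R)
    (Q : set (measurableTypeR R * measurableTypeR R)) :
  measurable Q -> measurable_fun [set: measurableTypeR R * measurableTypeR R] u
    ->
  measurable_fun [set: measurableTypeR R * measurableTypeR R]
    (fun y => \int[@lebesgue_measure2 R]_(x in Q) ((u x - u y) ^+ 2)%:E)%E.
Proof.
move=> mQ mu.
apply: (@measurable_integral_section _ _ _ _ R (@lebesgue_measure2 R)
  (fun z => ((u z.2 - u z.1) ^+ 2)%:E)) => //.
  apply/measurable_EFinP/measurable_funX/measurable_funB.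
    by apply: measurableT_comp => //; exact: measurable_snd.
  by apply: measurableT_comp => //; exact: measurable_fst.
by move=> z; rewrite lee_fin sqr_ge0.
Qed.

(** The points of Q are compared with the points g t of a segment on which u^2
is controlled; g parametrises horizontal and vertical segments alike. *)
Lemma le_integral_sq_segment (R : realType) (u : R * R -> R) (g : R -> R * R)
    (Q : set (measurableTypeR R * measurableTypeR R)) (b a q K : R)
    (E : R * R -> \bar R) :
  measurable Q -> (@lebesgue_measure2 R Q = q%:E)%E -> 0 <= q -> 0 <= K ->
    0 < a ->
  measurable_fun [set: measurableTypeR R * measurableTypeR R] u ->
  measurable_fun setT (fun t : measurableTypeR R => g t :
    measurableTypeR R * measurableTypeR R) ->
  measurable_fun [set: measurableTypeR R * measurableTypeR R] E ->
  (forall x, 0 <= E x)%E ->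
  (\int[@lebesgue_measure R]_(t in `[b, (b + a)%R[) (u (g t) ^+ 2)%:E <=
   K%:E * \int[@lebesgue_measure R]_(t in `[b, (b + a)%R[) E (g t))%E ->
  (a%:E * \int[@lebesgue_measure2 R]_(x in Q) (u x ^+ 2)%:E <=
   \int[@lebesgue_measure R]_(t in `[b, (b + a)%R[)
     (2%:E * \int[@lebesgue_measure2 R]_(x in Q) ((u x - u (g t)) ^+ 2)%:E +
      (2 * (q * K))%:E * E (g t)))%E.
Proof.
move=> mQ Qq q0 K0 a0 mu mg mE E0 line.
have mJ : measurable `[b, (b + a)%R[%classic by exact: measurable_itv.
have mD := measurable_integral_sqdiff mQ mu.
have mug : measurable_fun setT (fun t : measurableTypeR R => u (g t)).
  exact: (measurableT_comp mu mg).
have D0 y : (0 <= \int[@lebesgue_measure2 R]_(x in Q) ((u x - u y) ^+ 2)%:E)%E.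
  by apply: integral_ge0 => x _; rewrite lee_fin sqr_ge0.
have c20 : 0 <= 2 * (q * K) by rewrite mulr_ge0// mulr_ge0.
have mDg : measurable_fun setT (fun t : measurableTypeR R =>
    \int[@lebesgue_measure2 R]_(x in Q) ((u x - u (g t)) ^+ 2)%:E)%E.
  exact: (measurableT_comp mD mg).
have mEg : measurable_fun setT (fun t : measurableTypeR R => E (g t)).
  exact: (measurableT_comp mE mg).
rewrite ge0_integralD//; first last.
- by apply: measurable_funTS; exact: measurable_funeM.
- by move=> t _; rewrite mule_ge0.
- by apply: measurable_funTS; exact: measurable_funeM.
- by move=> t _; rewrite mule_ge0.
rewrite !ge0_integralZl//; try exact: measurable_funTS.
have pair : ((@lebesgue_measure R `[b, (b + a)%R[) *
     \int[@lebesgue_measure2 R]_(x in Q) (u x ^+ 2)%:E <=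
   ((1 + 1) / 1)%:E * (\int[@lebesgue_measure2 R]_(x in Q)
     \int[@lebesgue_measure R]_(t in `[b, (b + a)%R[) ((u x - u (g t)) ^+
       2)%:E) +
   ((1 + 1) / 1)%:E * (@lebesgue_measure2 R Q *
     \int[@lebesgue_measure R]_(t in `[b, (b + a)%R[) (u (g t) ^+ 2)%:E))%E.
  exact: (@integral_sq_pair _ _ _ _ R (@lebesgue_measure2 R) lebesgue_measure).
move: pair; rewrite lebesgue_measure_itvco// Qq divr1 => /le_trans; apply.
apply: leeD.
  rewrite (@tonelli_swap _ _ _ _ R (@lebesgue_measure2 R) lebesgue_measure
    (fun z => ((u z.1 - u (g z.2)) ^+ 2)%:E))//.
    apply/measurable_EFinP/measurable_funX/measurable_funB.
      by apply: measurableT_comp => //; exact: measurable_fst.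
    by apply: (measurableT_comp mug); exact: measurable_snd.
  by move=> ?; rewrite lee_fin sqr_ge0.
rewrite EFinM -muleA; apply: lee_wpmul2l; first by rewrite lee_fin.
rewrite EFinM -muleA; apply: lee_wpmul2l; first by rewrite lee_fin.
exact: line.
Qed.

(** The zero on the boundary of the square of radius r lies on a vertical and on
a horizontal segment crossing the cell; both meet the hypothesis of
[le_integral_sq_segment], and [integral_over_squares] concludes. *)
Lemma le_integral_sq_cell (R : realType) (u : R * R -> R) (s a q : R) (b p :
  R * R)
    (Q : set (measurableTypeR R * measurableTypeR R)) :
  continuous u -> 2^-1 < s < 1 -> 0 < a -> measurable Q ->
  (@lebesgue_measure2 R Q = q%:E)%E -> 0 <= q ->
  `|p - (b.1 + a / 2, b.2 + a / 2)| < a / 6 ->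
  (forall r, 0 < r < a / 3 -> exists2 y, u y = 0 & `|y - p| = r) ->
  ((a / 3 * a)%:E * \int[@lebesgue_measure2 R]_(x in Q) (u x ^+ 2)%:E <=
   8%:E * (\int[@lebesgue_measure2 R]_(y in square b a)
             \int[@lebesgue_measure2 R]_(x in Q) ((u x - u y) ^+ 2)%:E +
   (q * (54 / (2 * s - 1) * a `^ (2 * s)))%:E *
     \int[@lebesgue_measure2 R]_(y in square b a) energy u (2 + 2 * s) a y))%E.
Proof.
move=> cu s01 a0 mQ Qq q0 pc cross.
have mu := continuous_measurable2 cu.
have mE := measurable_energy (2 + 2 * s) a mu.
have E0 x := energy_ge0 u (2 + 2 * s) a x.
have mD := measurable_integral_sqdiff mQ mu.
have D0 y : (0 <= \int[@lebesgue_measure2 R]_(x in Q) ((u x - u y) ^+ 2)%:E)%E.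
  by apply: integral_ge0 => x _; rewrite lee_fin sqr_ge0.
set K := 54 / (2 * s - 1) * a `^ (2 * s).
have K0 : 0 <= K by rewrite mulr_ge0 ?powR_ge0// divr_ge0//; lra.
pose H (y : measurableTypeR R * measurableTypeR R) : \bar R :=
  (2%:E * \int[@lebesgue_measure2 R]_(x in Q) ((u x - u y) ^+ 2)%:E +
      (2 * (q * K))%:E * energy u (2 + 2 * s) a y)%E.
have mH : measurable_fun setT H.
  by apply: emeasurable_funD; exact: measurable_funeM.

have c20 : 0 <= 2 * (q * K) by rewrite mulr_ge0// mulr_ge0.
have H0 z : (0 <= H z)%E by rewrite /H adde_ge0// mule_ge0.
set e := (\int[_]_(x in Q) _)%E.
have e0 : (0 <= e)%E by apply: integral_ge0 => x _; rewrite lee_fin sqr_ge0.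
have mI t : measurable `[t, (t + a)%R[%classic by exact: measurable_itv.
have : ((a / 3)%:E * (a%:E * e) <=
  4%:E * \int[@lebesgue_measure2 R]_(y in square b a) H y)%E.
  move: pc; rewrite prod_norm_lt/= !ltr_norml => /andP[/andP[? ?] /andP[? ?]].
  apply: (@integral_over_squares _ H _ _ _ p) => //.
  - by rewrite mule_ge0// lee_fin ltW.
  - by rewrite divr_gt0.
  - by move=> r; rewrite ltr_norml => /andP[? ?]; rewrite /= !in_itv/=; split;
      lra.
  move=> r ra; have [y uy yp] := cross r ra; exists y => //.
  have : `|y - p| <= r by rewrite yp.
  rewrite prod_norm_le/= => /andP[y1 y2].
  move: ra y1 y2; rewrite !ler_norml => /andP[? ?] /andP[? ?] /andP[? ?].
  split.
    apply: (@le_integral_sq_segment _ u (fun t => (y.1, t)) Q b.2 a q K) => //.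
      exact: measurable_fun_pair.
    apply: (@integral_sq_zero_on_line _ u y.1 y.2) => //.
      by rewrite -surjective_pairing.
    by apply/andP; split; lra.
  apply: (@le_integral_sq_segment _ u (fun t => (t, y.2)) Q b.1 a q K) => //.
  apply: (@integral_sq_zero_on_hline _ u y.2 y.1) => //.
    by rewrite -surjective_pairing.
  by apply/andP; split; lra.
rewrite muleA -EFinM => /le_trans; apply.
have mS := measurable_square b a.
rewrite /H ge0_integralD//; first last.
- by apply: measurable_funTS; exact: measurable_funeM.
- by move=> t _; rewrite mule_ge0.
- by apply: measurable_funTS; exact: measurable_funeM.
- by move=> t _; rewrite mule_ge0.
rewrite !ge0_integralZl//; try exact: measurable_funTS.
have I1 : (0 <= \int[@lebesgue_measure2 R]_(y in square b a)
   \int[@lebesgue_measure2 R]_(x in Q) ((u x - u y) ^+ 2)%:E)%E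
     by exact: integral_ge0.
have I2 : (0 <= \int[@lebesgue_measure2 R]_(y in square b a) energy u (2 + 2 *
  s) a y)%E.
  by apply: integral_ge0 => y _; exact: energy_ge0.
move: I1 I2; set A := (\int[_]_(y in _) \int[_]_(x in _) _)%E.
set B := (\int[_]_(y in _) energy _ _ _ _)%E; move: A B => A B A0 B0.
have qK0 : 0 <= q * K by exact: mulr_ge0.
rewrite !ge0_muleDr ?mule_ge0 ?lee_fin// !muleA -!EFinM.
rewrite le_eqVlt; apply/orP; left; apply/eqP.
by congr (_%:E * _ + _%:E * _)%E; ring.
Qed.

(** * Poincare inequality on a square and on the plane *)

Lemma square_half_open_inj (R : realType) (L t : R) (i j : int) : 0 < L ->
  i%:~R * L <= t < i%:~R * L + L -> j%:~R * L <= t < j%:~R * L + L -> i = j.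
Proof.
move=> L0 /andP[i1 i2] /andP[j1 j2]; apply/eqP; rewrite eq_le.
have lt1 (m n : int) : m%:~R * L <= t -> t < n%:~R * L + L -> (m <= n)%R.
  move=> h1 h2; have : m%:~R * L < (n%:~R + 1) * L by rewrite mulrDl mul1r; lra.
  by rewrite ltr_pM2r// -[X in _ + X]/(1%:~R) -intrD ltr_int ltzD1.
by rewrite !lt1.
Qed.

(** The tiles indexed by pairs of integers are enumerated by [pickle_inv], whose
sharpness makes the enumeration repetition-free. *)
Lemma le_integral_tiling (R : realType) (L : R)
    (f g : measurableTypeR R * measurableTypeR R -> \bar R) :
  0 < L -> measurable_fun setT f -> measurable_fun setT g ->
  (forall x, 0 <= f x)%E -> (forall x, 0 <= g x)%E ->
  (forall b, \int[@lebesgue_measure2 R]_(x in square b L) f x <=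
             \int[@lebesgue_measure2 R]_(x in square b L) g x)%E ->
  (\int[@lebesgue_measure2 R]_x f x <= \int[@lebesgue_measure2 R]_x g x)%E.
Proof.
move=> L0 mf mg f0 g0 H.
pose tile (ij : int * int) := square (ij.1%:~R * L, ij.2%:~R * L) L.
pose S n := if pickle_inv n is Some ij then tile ij else set0.
have mS n : measurable (S n).
  by rewrite /S; case: pickle_inv => // ij; exact: measurable_square.
have ST : setT = \bigcup_n S n.
  apply/esym/seteqP; split => // x _.
  have fl (t : R) : (Num.floor (t / L))%:~R * L <=
    t < (Num.floor (t / L))%:~R * L + L.
    have /andP[] := floor_itv (t / L);
      rewrite intrD ler_pdivlMr// ltr_pdivrMr//.
    by rewrite mulrDl mul1r => -> ->.
  pose ij : int * int := (Num.floor (x.1 / L), Num.floor (x.2 / L)).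
  exists (pickle ij); first exact: I.
  by rewrite /S pickleK_inv; split; rewrite /= in_itv/= fl.
have tS : trivIset setT S.
  apply/trivIsetP => m n _ _ mn; apply/seteqP; split => // x; rewrite /S.
  have := pickle_invK (T := (int * int)%type) m.
  have := pickle_invK (T := (int * int)%type) n.
  case: pickle_inv => [j|]/=; last by move=> _ _ [].
  case: pickle_inv => [i|]/=; last by move=> _ _ [].
  move=> jn im; rewrite /tile /square /= !in_itv/= => -[[i1 i2] [j1 j2]].
  move/eqP: mn; apply;
    rewrite -im -jn (surjective_pairing i) (surjective_pairing j).
  by rewrite (square_half_open_inj L0 i1 j1) (square_half_open_inj L0 i2 j2).
rewrite ST !ge0_integral_bigcup//; try exact: measurable_funTS.
apply: lee_nneseries => [n _ _|n _]; first by apply: integral_ge0 => x _.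
by rewrite /S; case: pickle_inv => [ij|]; [exact: H|rewrite !integral_set0].
Qed.

(** Inside a square of side L the kernel is at least L^(-p). *)
Lemma le_integral_sqdiff_energy (R : realType) (u : R * R -> R) (p L : R)
    (b y : R * R) :
  measurable_fun [set: measurableTypeR R * measurableTypeR R] u -> 0 < L ->
    0 <= p ->
  square b L y ->
  (\int[@lebesgue_measure2 R]_(x in square b L) ((u x - u y) ^+ 2)%:E <=
   (L `^ p)%:E * energy u p L y)%E.
Proof.
move=> mu L0 p0 [/= y1 y2].
have mS := measurable_square b L.
have md : measurable_fun setT (fun x : measurableTypeR R * measurableTypeR R =>
    (energy_density u p L (y, x))%:E).
  by apply/measurable_EFinP;
    apply: (measurableT_comp (measurable_energy_density p L mu)).
have d0 x : (0 <= (energy_density u p L (y, x))%:E)%E.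
  by rewrite lee_fin energy_density_ge0.
rewrite /energy -ge0_integralZl//; last by rewrite lee_fin powR_ge0.
apply: (@le_trans _ _ (\int[@lebesgue_measure2 R]_(x in square b L)
   ((L `^ p)%:E * (energy_density u p L (y, x))%:E))%E); last first.
  apply: ge0_subset_integral => //; first exact: measurable_funeM.
  by move=> x _; rewrite mule_ge0// lee_fin powR_ge0.
apply: ge0_le_integral => //.
- by move=> x _; rewrite lee_fin sqr_ge0.
- apply/measurable_EFinP/measurable_funX/measurable_funB => //.
  exact: measurable_funTS.
- by apply: measurable_funTS; exact: measurable_funeM.
move=> x [/= x1 x2]; rewrite -EFinM lee_fin /energy_density/=.
move: y1 y2 x1 x2; rewrite !in_itv/= => /andP[? ?] /andP[? ?] /andP[? ?]
  /andP[? ?].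
have yxL : `|y - x : R * R| <= L by rewrite prod_norm_le/= !ler_norml; lra.
rewrite yxL -sqrrN opprB.
have [e|e] := eqVneq `|y - x : R * R| 0.
  move/eqP: e; rewrite normr_eq0 subr_eq0 => /eqP ->.
  by rewrite subrr expr0n mul0r mulr0.
have d : 0 < `|y - x : R * R| by rewrite lt_neqAle eq_sym e normr_ge0.
rewrite mulrCA ler_peMr ?sqr_ge0// powRN ler_pdivlMr ?powR_gt0// mul1r.
by rewrite ge0_ler_powR ?nnegrE// ltW.
Qed.

Lemma ler_dist_nat (R : realType) (m n : nat) (a : R) : 0 < a -> m != n ->
  a <= `|m%:R * a - n%:R * a|.
Proof.
move=> a0 mn; rewrite -mulrBl normrM (gtr0_norm a0).
apply: ler_peMl; first exact: ltW.
have le1 (i j : nat) : (i < j)%N -> 1 <= `|i%:R - j%:R| :> R.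
  by move=> ij; rewrite distrC -natrB ?(ltnW ij)// normr_nat ler1n subn_gt0.
by case: (ltngtP m n) mn => // h _; [|rewrite distrC]; exact: le1.
Qed.

(** At least N^2 - k >= N^2 / 2 of the cells are good.  Adding up
[le_integral_sq_cell] over them puts a fixed multiple of the area of Q on the
left, against the area of Q times L^(2 s) times the energy on the right. *)
Lemma le_integral_sq_square (R : realType) (Omega : set (R * R)) (k N : nat)
    (u : R * R -> R) (rho s L : R) (b : R * R) :
  multiply_connected k Omega -> continuous u -> (forall y, ~ Omega y ->
    u y = 0) ->
  0 < rho -> (forall x, exists2 p, ~ Omega p & `|p - x| < rho) ->
  2^-1 < s < 1 -> (0 < N)%N -> (2 * k <= N ^ 2)%N ->
  L = N%:R * (6 * rho) ->
  (\int[@lebesgue_measure2 R]_(x in square b L) (u x ^+ 2)%:E <=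
   (2640 / (2 * s - 1) * L `^ (2 * s))%:E *
   \int[@lebesgue_measure2 R]_(y in square b L) energy u (2 + 2 * s) L y)%E.
Proof.
move=> mc cu u0 rho0 hit s01 N0 kN LE.
pose a := 6 * rho; have a0 : 0 < a by exact: mulr_gt0.
have NR1 : 1 <= N%:R :> R by rewrite ler1n.
have aL : a <= L by rewrite LE -/a ler_peMl// ltW.
have L0 : 0 < L by apply: lt_le_trans aL.
have mu := continuous_measurable2 cu.
pose Q := square b L; have mQ : measurable Q by exact: measurable_square.
pose K := 54 / (2 * s - 1) * a `^ (2 * s).
have K0 : 0 <= K by rewrite mulr_ge0 ?powR_ge0// divr_ge0//; lra.
have Qq : (@lebesgue_measure2 R Q = (L ^+ 2)%:E)%E.
  rewrite lebesgue_measure2X; try exact: measurable_itv.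
  by rewrite !lebesgue_measure_itvco// -EFinM expr2.
have q0 : 0 <= L ^+ 2 by rewrite sqr_ge0.
pose T : finType := ('I_N * 'I_N)%type.
pose base (i : T) : R * R := (b.1 + i.1%:R * a, b.2 + i.2%:R * a).
pose c (i : T) : R * R := ((base i).1 + a / 2, (base i).2 + a / 2).
have far i j : i != j -> 6 * rho <= `|c i - c j|.
  move=> ij; rewrite -/a prod_normE le_max /c/=.
  have e (x y z w : R) : x + y + z - (x + w + z) = y - w by ring.
  rewrite !e; move: ij; case: i => i1 i2; case: j => j1 j2;
    rewrite xpair_eqE negb_and.
  by case/orP => ij; apply/orP; [left|right]; exact: ler_dist_nat.
have [G [Gcard Gcross]] := many_cells_crossed mc hit far.
pose D y := (\int[@lebesgue_measure2 R]_(x in Q) ((u x - u y) ^+ 2)%:E)%E.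
have D0 y : (0 <= D y)%E by apply: integral_ge0 => x _; rewrite lee_fin sqr_ge0.
have mD : measurable_fun setT D by exact: measurable_integral_sqdiff.
have mE d := measurable_energy (2 + 2 * s) d mu.
have E0 d x := energy_ge0 u (2 + 2 * s) d x.
pose F y := (D y + (L ^+ 2 * K)%:E * energy u (2 + 2 * s) a y)%E.
have qK0 : 0 <= L ^+ 2 * K by exact: mulr_ge0.
have F0 y : (0 <= F y)%E by rewrite adde_ge0// mule_ge0.
have mF : measurable_fun setT F.
  by apply: emeasurable_funD => //; apply: measurable_funeM; exact: mE.
set I := (\int[_]_(x in _) _)%E.
set J := (\int[_]_(x in _) energy _ _ _ _)%E.
have I0 : (0 <= I)%E by apply: integral_ge0 => x _; rewrite lee_fin sqr_ge0.
have J0 : (0 <= J)%E by apply: integral_ge0 => y _; exact: E0.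
have mcell i : measurable (square (base i) a) by exact: measurable_square.
have cell i : i \in G -> ((a / 3 * a)%:E * I <=
    8%:E * \int[@lebesgue_measure2 R]_(y in square (base i) a) F y)%E.
  move=> iG; have [p pc pcross] := Gcross i iG.
  rewrite /F ge0_integralD//; first last.
  - by apply: measurable_funTS; exact: measurable_funeM.
  - by move=> y _; rewrite mule_ge0.
  - exact: measurable_funTS.
  rewrite ge0_integralZl//; last exact: measurable_funTS.
  apply: (@le_integral_sq_cell _ _ _ _ _ _ p Q) => //.
    by rewrite -/(c i); apply: lt_le_trans pc _; rewrite /a; lra.
  move=> r ra; have [|y nOy yp] := pcross r; first by move: ra; rewrite /a; lra.
  by exists y => //; exact: u0.
have sumcells : (\sum_(i in G) \int[@lebesgue_measure2 R]_(y in square (base i)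
  a) F y
   <= \int[@lebesgue_measure2 R]_(y in Q) F y)%E.
  have tcells : trivIset [set` enum G] (fun i => square (base i) a).
    apply/trivIsetP => i j _ _ ij; apply/seteqP;
      split => // x [[/= i1 i2] [/= j1 j2]].
    have := far _ _ ij; rewrite -/a leNgt => /negP; apply.
    move: i1 i2 j1 j2; rewrite !in_itv/= => /andP[? ?] /andP[? ?] /andP[? ?]
      /andP[? ?].
    clear cell I0 J0 F0 D0 E0.
    by rewrite prod_norm_lt/= !ltr_norml; lra.
  have mU : measurable (\big[setU/set0]_(i <- enum G) square (base i) a).
    by apply: bigsetU_measurable => i _; exact: mcell.
  rewrite -big_enum/= -(ge0_integral_bigsetU _ mcell (enum_uniq _) tcells)//;
    last first.
    exact: measurable_funTS.
  apply: ge0_subset_integral => //; first exact: measurable_funTS.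
  move=> x; rewrite -bigcup_seq => -[[i1 i2] _ [/= x1 x2]].
  have iN (i : 'I_N) : 0 <= i%:R * a /\ i%:R * a + a <= L.
    split; first by rewrite mulr_ge0// ltW.
    by rewrite LE -/a -[X in _ + X]mul1r -mulrDl ler_pM2r// natr1 ler_nat.
  clear cell I0 J0 F0 D0 E0.
  have [? ?] := iN i1; have [? ?] := iN i2.
  move: x1 x2; rewrite /Q /square/= !in_itv/= => /andP[? ?] /andP[? ?].
  by split; lra.
have FQ : (\int[@lebesgue_measure2 R]_(y in Q) F y <=
    (L `^ (2 + 2 * s) + L ^+ 2 * K)%:E * J)%E.
  rewrite /J -ge0_integralZl//; last 2 first.
  - exact: measurable_funTS.
  - by rewrite lee_fin addr_ge0// powR_ge0.
  apply: ge0_le_integral => //.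
  - exact: measurable_funTS.
  - by apply: measurable_funTS; exact: measurable_funeM.
  move=> y Qy; rewrite EFinD ge0_muleDl ?lee_fin ?powR_ge0//.
  apply: leeD; first by apply: le_integral_sqdiff_energy => //; lra.
  by apply: lee_wpmul2l => //; exact: le_energy.
have total : ((#|G|%:R * (a / 3 * a))%:E * I <=
    (8 * (L `^ (2 + 2 * s) + L ^+ 2 * K))%:E * J)%E.
  rewrite (EFinM 8) -[leRHS]muleA.
  apply: le_trans (lee_wpmul2l _ (le_trans sumcells FQ)); last by [].
  rewrite ge0_sume_distrr; last by move=> i _; apply: integral_ge0 => y _;
    exact: F0.
  apply: le_trans (lee_sum _ cell).
  rewrite -ge0_sume_distrl; last first.
    by move=> i _; rewrite lee_fin mulr_ge0 ?divr_ge0// ltW.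
  by rewrite sumEFin sumr_const mulr_natl.
have GN : N%:R ^+ 2 / 2 <= #|G|%:R :> R.
  rewrite ler_pdivrMr// -natrX -natrM ler_nat.
  move: Gcard kN; rewrite card_prod !card_ord mulnn.
  by move: #|G| (N ^ 2)%N => g n; clear; lia.
have Ls : L `^ (2 + 2 * s) = L ^+ 2 * L `^ (2 * s).
  by rewrite powRD ?(gt_eqF L0) ?implybT// powR_mulrn ?ltW.
have aLs : a `^ (2 * s) <= L `^ (2 * s).
  by apply: ge0_ler_powR => //; rewrite ?nnegrE ?ltW//; lra.
have s20 : 0 < 2 * s - 1 by lra.
have Ls0 : 0 < L `^ (2 * s) by exact: powR_gt0.
have KL : L `^ (2 * s) + K <= 55 / (2 * s - 1) * L `^ (2 * s).
  have : K <= 54 / (2 * s - 1) * L `^ (2 * s).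
    by rewrite ler_pM2l// divr_gt0.
  have : L `^ (2 * s) <= 1 / (2 * s - 1) * L `^ (2 * s).
    by apply: ler_peMl; [exact: ltW|rewrite ler_pdivlMr//; lra].
  have -> : 55 / (2 * s - 1) = 54 / (2 * s - 1) + 1 / (2 * s - 1)
    by rewrite -mulrDl; congr (_ / _); ring.
  by rewrite mulrDl; lra.
have L20 : 0 < L ^+ 2 by rewrite exprn_gt0.
have step : ((L ^+ 2 / 6)%:E * I <=
    (8 * (L ^+ 2 * (55 / (2 * s - 1) * L `^ (2 * s))))%:E * J)%E.
  apply: (@le_trans _ _ ((#|G|%:R * (a / 3 * a))%:E * I)%E).
    apply: lee_wpmul2r => //; rewrite lee_fin.
    have -> : L ^+ 2 / 6 = N%:R ^+ 2 / 2 * (a / 3 * a) by rewrite LE -/a; field.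
    by rewrite ler_wpM2r// mulr_ge0 ?divr_ge0// ltW.
  apply: (le_trans total); apply: lee_wpmul2r => //.
  by rewrite lee_fin Ls -mulrDr !ler_pM2l.
have c0 : (0 <= (6 / L ^+ 2)%:E)%E by rewrite lee_fin divr_ge0.
have := lee_wpmul2l c0 step; rewrite !muleA -!EFinM.
have -> : 6 / L ^+ 2 * (L ^+ 2 / 6) = 1 by field; rewrite gt_eqF.
rewrite mul1e => /le_trans; apply; apply: lee_wpmul2r => //.
rewrite lee_fin le_eqVlt; apply/orP; left; apply/eqP.
by field; rewrite !gt_eqF.
Qed.

(** * Comparison of the energies of two exponents *)

Lemma integral2_affine (R : realType) (a : R) (b : R * R)
    (f : measurableTypeR R * measurableTypeR R -> \bar R) :
  a != 0 -> measurable_fun setT f -> (forall z, 0 <= f z)%E ->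
  (\int[@lebesgue_measure2 R]_z f (a * z.1 + b.1, a * z.2 + b.2)%R =
   (`|a|^-1 * `|a|^-1)%:E * \int[@lebesgue_measure2 R]_z f z)%E.
Proof.
move=> a0 mf f0.
have maff (c : R) : measurable_fun setT (fun r :
  measurableTypeR R => a * r + c : measurableTypeR R).
  by apply: measurable_funD => //; exact: measurable_funM.
have mfa : measurable_fun setT (fun z : measurableTypeR R * measurableTypeR R =>
    f (a * z.1 + b.1, a * z.2 + b.2)).
  apply: (measurableT_comp mf (g := fun z => (a * z.1 + b.1, a * z.2 + b.2))).
  apply: measurable_fun_pair.
    by apply: (measurableT_comp (maff b.1)); exact: measurable_fst.
  by apply: (measurableT_comp (maff b.2)); exact: measurable_snd.
rewrite (integral2_tonelli mfa (fun z => f0 _)) (integral2_tonelli mf f0)/=.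
pose g x := (\int[@lebesgue_measure R]_y f (x, y))%E.
have g0 x : (0 <= g x)%E by apply: integral_ge0 => y _; exact: f0.
have mg : measurable_fun setT g.
  by apply: (@measurable_integral_section _ _ _ _ R lebesgue_measure f).
transitivity (\int[@lebesgue_measure R]_x (`|a|^-1%:E * g (a * x + b.1)%R))%E.
  apply: eq_integral => x _.
  apply: (@ge0_integral_affine _ a b.2 (fun y => f (a * x + b.1, y))) => //.
  exact: measurable_fun_pair2.
rewrite ge0_integralZl.
- by rewrite (ge0_integral_affine b.1 a0 mg g0) muleA -EFinM.
- exact: measurableT.
- exact: (measurableT_comp mg).
- by move=> x _; exact: g0.
- by rewrite lee_fin.
Qed.

Section total_energy.
Variables (R : realType) (u : R * R -> R).
Hypothesis mu : measurable_fun [set: measurableTypeR R * measurableTypeR R] u.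

Definition total_energy p d := (\int[@lebesgue_measure2 R]_x energy u p d x)%E.

Lemma total_energy_ge0 p d : (0 <= total_energy p d)%E.
Proof. by apply: integral_ge0 => x _; exact: energy_ge0. Qed.

Lemma le_total_energy p d d' : d <= d' ->
  (total_energy p d <= total_energy p d')%E.
Proof.
move=> dd'; apply: ge0_le_integral => //.
- by move=> x _; exact: energy_ge0.
- exact: measurable_energy.
- exact: measurable_energy.
- by move=> x _; exact: le_energy.
Qed.

Let T : Type := ((measurableTypeR R * measurableTypeR R) *
  (measurableTypeR R * measurableTypeR R))%type.

Lemma total_energyE p d : total_energy p d =
  (\int[(@lebesgue_measure2 R \x @lebesgue_measure2 R)]_z (energy_density u p d
    z)%:E)%E.
Proof.
rewrite fubini_tonelli1//.
- by apply/measurable_EFinP; apply: measurable_energy_density.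
- by move=> z; rewrite lee_fin energy_density_ge0.
Qed.

Definition midpoint (x y : R * R) : R * R :=
  (2^-1 * y.1 + x.1 / 2, 2^-1 * y.2 + x.2 / 2).

Lemma density_midpoint p d (z : T) :
  energy_density u p d z <=
  2 * (2 `^ (- p) * energy_density u p (d / 2) (z.1, midpoint z.1 z.2)) +
  2 * (2 `^ (- p) * energy_density u p (d / 2) (z.2, midpoint z.2 z.1)).
Proof.
case: z => x y /=.
have half (a b : R * R) : `|a - midpoint a b : R * R| = `|a - b : R * R| / 2.
  have h (s t : R) : `|s - (2^-1 * t + s / 2)| = 2^-1 * `|s - t|.
    have -> : s - (2^-1 * t + s / 2) = 2^-1 * (s - t) by field.
    by rewrite normrM ger0_norm.
  by rewrite !prod_normE/= !h -maxr_pMr// mulrC.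
have mC : midpoint y x = midpoint x y by rewrite /midpoint; congr (_, _); ring.
have e2 (t : R) : 0 <= t -> (t / 2) `^ (- p) = 2 `^ p * t `^ (- p).
  by move=> t0; rewrite powRM ?invr_ge0// mulrC -powR_inv1// -powRrM mulN1r
    opprK.
rewrite /energy_density/= !half mC [`|y - x : R * R|]distrC !ler_pM2r//.
case: ifP => _; last by rewrite !mulr0 addr0.
rewrite !e2//; have ptp : 2 `^ (- p) * 2 `^ p = 1 :> R.
  by rewrite -powRD ?pnatr_eq0 ?implybT// addNr powRr0.
have := powR_ge0 `|x - y : R * R| (- p);
  move: (`|x - y : R * R| `^ (- p)) => w w0.
move: (u x) (u y) (u (midpoint x y)) => a b m.

have -> : 2 * (2 `^ (- p) * ((a - m) ^+ 2 * (2 `^ p * w))) =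
   2 * (a - m) ^+ 2 * w * (2 `^ (- p) * 2 `^ p) by ring.
have -> : 2 * (2 `^ (- p) * ((b - m) ^+ 2 * (2 `^ p * w))) =
   2 * (b - m) ^+ 2 * w * (2 `^ (- p) * 2 `^ p) by ring.
rewrite ptp !mulr1 -mulrDl ler_wpM2r// -subr_ge0.
have -> : 2 * (a - m) ^+ 2 + 2 * (b - m) ^+ 2 - (a - b) ^+ 2 =
  (a + b - 2 * m) ^+ 2 by ring.
exact: sqr_ge0.
Qed.

(** Insert the midpoint m of x and y.  The two resulting terms have the same
integral, and the change of variables from y to m doubles distances, whence
the power of 2. *)
Lemma total_energy_doubling p d :
  (total_energy p d <= (16 * 2 `^ (- p))%:E * total_energy p (d / 2))%E.
Proof.
have md := measurable_energy_density p (d / 2) mu.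
pose M (z : T) := (2 * (2 `^ (- p) * energy_density u p (d / 2) (z.1, midpoint
  z.1 z.2)))%:E.
have M0 z : (0 <= M z)%E.
  by rewrite lee_fin mulr_ge0// mulr_ge0 ?powR_ge0 ?energy_density_ge0.
have mmid : measurable_fun setT (fun z : T => (z.1, midpoint z.1 z.2)).
  apply: measurable_fun_pair; first exact: measurable_fst.
  by apply: measurable_fun_pair; apply: measurable_funD;
    apply: measurable_funM => //;
    apply: measurableT_comp.
have mM : measurable_fun setT M.
  apply/measurable_EFinP/measurable_funM; first exact: measurable_cst.
  apply: measurable_funM; first exact: measurable_cst.
  exact: (measurableT_comp md mmid).
have mMs : measurable_fun setT (fun z : T => M (z.2, z.1)).
  apply: (measurableT_comp mM (g := fun z : T => (z.2, z.1))).
  by apply: measurable_fun_pair; [exact: measurable_snd|exact: measurable_fst].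
pose I := (\int[@lebesgue_measure2 R]_x \int[@lebesgue_measure2 R]_y M (x,
  y))%E.
have IE : (I = (8 * 2 `^ (- p))%:E * total_energy p (d / 2))%E.
  rewrite /total_energy -ge0_integralZl; first last.
  - by rewrite lee_fin mulr_ge0// powR_ge0.
  - by move=> x _; exact: energy_ge0.
  - exact: measurable_energy.
  - exact: measurableT.
  apply: eq_integral => x _.
  have mx : measurable_fun setT (fun y => (energy_density u p (d / 2) (x,
    y))%:E).
    by apply/measurable_EFinP; apply: (measurableT_comp md).
  have x0 y : (0 <= (energy_density u p (d / 2) (x, y))%:E)%E.
    by rewrite lee_fin energy_density_ge0.
  have h0 : (2^-1 : R) != 0 by rewrite invr_eq0 pnatr_eq0.
  have := integral2_affine (x.1 / 2, x.2 / 2) h0 mx x0.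
  rewrite gtr0_norm// invrK => aff.
  rewrite /M; under eq_integral do rewrite mulrA EFinM.
  rewrite ge0_integralZl; first last.
  - by rewrite lee_fin mulr_ge0// powR_ge0.
  - by move=> y _; rewrite lee_fin energy_density_ge0.
  - apply/measurable_EFinP; apply: (measurableT_comp md).
    exact: (measurableT_comp mmid).
  - exact: measurableT.
  rewrite aff muleA -EFinM; congr (_%:E * _)%E; ring.
rewrite total_energyE.
apply: (@le_trans _ _ (\int[(@lebesgue_measure2 R \x @lebesgue_measure2 R)]_z
   (M z + M (z.2, z.1)))%E).
  apply: ge0_le_integral => //.
  - by move=> z _; rewrite lee_fin energy_density_ge0.
  - by apply/measurable_EFinP; apply: measurable_energy_density.
  - by apply: emeasurable_funD; [exact: mM|exact: mMs].
  - by move=> z _; rewrite -EFinD lee_fin; exact: density_midpoint.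
rewrite ge0_integralD; [|exact: measurableT|by move=> z _; exact: M0|exact: mM|
  by move=> z _; exact: M0|exact: mMs].
rewrite (fubini_tonelli1 _ mM M0) (fubini_tonelli2 _ mMs (fun z => M0 _)).
rewrite /fubini_F /fubini_G/= -/I IE.
rewrite -ge0_muleDl ?lee_fin ?mulr_ge0 ?powR_ge0// -EFinD.
by rewrite le_eqVlt; apply/orP; left; apply/eqP; congr (_%:E * _)%E; ring.
Qed.

End total_energy.

Lemma density_annulus (R : realType) (u : R * R -> R) (p0 p d : R) z :
  0 < d -> p0 <= p ->
  energy_density u p0 d z + d `^ (p - p0) * energy_density u p (d / 2) z <=
  d `^ (p - p0) * energy_density u p d z + energy_density u p0 (d / 2) z.
Proof.
move=> d0 pp; rewrite /energy_density; set r := `|_|.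
have r0 : 0 <= r by exact: normr_ge0.
have [rd2|rd2] := leP r (d / 2).
  have -> : r <= d by lra.
  by rewrite addrC.
rewrite mulr0 !addr0; case: ifP => rd; last by rewrite mulr0.
rewrite mulrCA ler_wpM2l ?sqr_ge0//.
have rp : 0 < r by apply: lt_trans rd2; rewrite divr_gt0.
have -> : r `^ (- p0) = r `^ (p - p0) * r `^ (- p).
  by rewrite -powRD ?(gt_eqF rp) ?implybT//; congr (_ `^ _); ring.
apply: ler_wpM2r; first exact: powR_ge0.
by apply: ge0_ler_powR; rewrite ?nnegrE ?subr_ge0// ltW.
Qed.

(** Between the ranges d / 2 and d the kernel of exponent p0 is at most
d^(p - p0) times that of exponent p.  The inequality is written without
subtraction because the energies may be infinite. *)
Lemma total_energy_annulus (R : realType) (u : R * R -> R) (p0 p d : R) :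
  measurable_fun [set: measurableTypeR R * measurableTypeR R] u ->
  0 < d -> p0 <= p ->
  (total_energy u p0 d + (d `^ (p - p0))%:E * total_energy u p (d / 2) <=
   (d `^ (p - p0))%:E * total_energy u p d + total_energy u p0 (d / 2))%E.
Proof.
move=> mu d0 pp; rewrite !total_energyE//.
have m q e : measurable_fun setT (fun z => (energy_density u q e z)%:E).
  by apply/measurable_EFinP; exact: measurable_energy_density.
have c0 : (0 <= (d `^ (p - p0))%:E)%E by rewrite lee_fin powR_ge0.
have e0 q e : forall z, setT z -> (0 <= (energy_density u q e z)%:E)%E.
  by move=> z _; rewrite lee_fin energy_density_ge0.
have ce0 q e : forall z, setT z ->
  (0 <= (d `^ (p - p0))%:E * (energy_density u q e z)%:E)%E.
  by move=> z _; rewrite mule_ge0// e0.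
have cm q e : measurable_fun setT (fun z => ((d `^ (p - p0))%:E *
  (energy_density u q e z)%:E)%E).
  by apply: measurable_funeM; exact: m.
rewrite -!(ge0_integralZl _ measurableT (m _ _) (e0 _ _) c0).
rewrite -(ge0_integralD _ measurableT (e0 _ _) (m _ _) (ce0 _ _) (cm _ _)).
rewrite -(ge0_integralD _ measurableT (ce0 _ _) (cm _ _) (e0 _ _) (m _ _)).
apply: ge0_le_integral.
- exact: measurableT.
- by move=> z _; apply: adde_ge0; [exact: e0|exact: ce0].
- by apply: emeasurable_funD; [exact: m|exact: cm].
- by apply: emeasurable_funD; [exact: cm|exact: m].
- by move=> z _; rewrite -!EFinM -!EFinD lee_fin; exact: density_annulus.
Qed.

Lemma one_sub_powR_le (R : realType) (x : R) : 0 <= x -> 1 - 2 `^ (- x) <= x.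
Proof.
move=> x0; rewrite /powR pnatr_eq0/=.
have := expR_ge1Dx (- x * ln 2 : R).
have : ln 2 <= 1 :> R.
  by rewrite -[leRHS]expRK ler_ln ?posrE ?expR_gt0//;
    have := expR_ge1Dx (1 : R); lra.
nra.
Qed.

Lemma le0_of_geometric (R : realType) (x c r : R) : 0 <= r < 1 -> 0 <= c ->
  (forall n, x <= c * r ^+ n) -> x <= 0.
Proof.
move=> /andP[r0 r1] c0 H.
have : (fun n => c * r ^+ n) @ \oo --> c * 0.
  by apply: cvgM; [exact: cvg_cst|apply: cvg_expr; rewrite ger0_norm].
rewrite mulr0 => cv; rewrite -(cvg_lim _ cv)//.
by apply: limr_ge; [exact: cvgP cv|exact: nearW].
Qed.

(** By doubling, the pairs between the ranges d / 2 and d carry at most a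
fraction 4 - p of the energy of exponent p.  Summing the bound of
[total_energy_annulus] over the ranges L / 2^j gives a geometric series of
ratio 2^(p0 - p). *)
Lemma total_energy_lower_exponent (R : realType) (u : R * R -> R) (p0 p L : R) :
  measurable_fun [set: measurableTypeR R * measurableTypeR R] u ->
  0 < L -> 0 < p0 -> 0 < p - p0 < 1 -> p < 4 ->
  (total_energy u p0 L <=
   (3 / (p - p0) * (4 - p) * L `^ (p - p0))%:E * total_energy u p L)%E.
Proof.
move=> mu L0 p00 pp p4; have /andP[pp0 pp1] := pp.
have cpos : 0 < 3 / (p - p0) * (4 - p) * L `^ (p - p0).
  by rewrite !mulr_gt0 ?powR_gt0 ?invr_gt0; lra.
set c := 3 / (p - p0) * (4 - p) * L `^ (p - p0) in cpos *.
case: (leP +oo%E (total_energy u p L)) => [|fin].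
  by rewrite leye_eq => /eqP ->; rewrite gt0_muley ?lte_fin// leey.
pose F := fine (total_energy u p L).
have FE : total_energy u p L = F%:E.
  by rewrite fineK// (ge0_fin_numE (total_energy_ge0 u p L)).
have F0 : 0 <= F by rewrite -lee_fin -FE total_energy_ge0.
have lowfin d : 0 < d <= L ->
  exists2 f, total_energy u p d = f%:E & 0 <= f <= F.
  move=> /andP[d0 dL]; have le := le_total_energy mu p dL.
  have fd : total_energy u p d \is a fin_num.
    rewrite (ge0_fin_numE (total_energy_ge0 u p d)); exact: le_lt_trans le fin.
  exists (fine (total_energy u p d)); first by rewrite fineK.
  have f0 := total_energy_ge0 u p d; move: f0 le.
  by rewrite -(fineK fd) FE !lee_fin => -> ->.
have base d : 0 < d <= L ->
  exists2 e, total_energy u p0 d = e%:E & e <= d `^ (p - p0) * F.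
  move=> dL; have /andP[d0 _] := dL; have [f fE /andP[f0 fF]] := lowfin d dL.
  have le : (total_energy u p0 d <= (d `^ (p - p0) * F)%:E)%E.
    apply: (@le_trans _ _ ((d `^ (p - p0))%:E * total_energy u p d)%E);
      last first.
      by rewrite fE -EFinM lee_fin ler_wpM2l ?powR_ge0.
    rewrite !total_energyE// -ge0_integralZl//; first last.
    - by rewrite lee_fin powR_ge0.
    - by move=> z _; rewrite lee_fin energy_density_ge0.
    - by apply/measurable_EFinP; exact: measurable_energy_density.
    apply: ge0_le_integral => //.
    - by move=> z _; rewrite lee_fin energy_density_ge0.
    - by apply/measurable_EFinP; exact: measurable_energy_density.
    - by apply: measurable_funeM; apply/measurable_EFinP;
        exact: measurable_energy_density.
    move=> z _; rewrite -EFinM lee_fin /energy_density; set r := `|_|.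
    case: ifP => rd; last by rewrite mulr0.
    rewrite mulrCA ler_wpM2l ?sqr_ge0//.
    have : 0 <= r by exact: normr_ge0.
    rewrite le_eqVlt => /orP[/eqP <-|rp].
      rewrite (@powR0 _ (- p0)) ?oppr_eq0 ?gt_eqF//.
      by apply: mulr_ge0; exact: powR_ge0.
    have -> : r `^ (- p0) = r `^ (p - p0) * r `^ (- p).
      by rewrite -powRD ?(gt_eqF rp) ?implybT//; congr (_ `^ _); ring.
    apply: ler_wpM2r; first exact: powR_ge0.
    by apply: ge0_ler_powR; rewrite ?nnegrE// ltW.
  have e0 := total_energy_ge0 u p0 d.
  have fe : total_energy u p0 d \is a fin_num.
    rewrite (ge0_fin_numE e0); apply: le_lt_trans le _; exact: ltry.
  exists (fine (total_energy u p0 d)); first by rewrite fineK.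
  by rewrite -lee_fin fineK.
pose r : R := 2^-1 `^ (p - p0).
have r1 : (p - p0) / 3 <= 1 - r by exact: one_sub_powR_half.
have r0 : 0 <= r by rewrite powR_ge0.
pose S := (1 - r)^-1.
have S0 : 0 < S by rewrite invr_gt0; lra.
have Sr : 1 + r * S = S.
  by rewrite -[X in X + _](@mulfV _ (1 - r)) -/S; [ring|rewrite gt_eqF//; lra].
(* S sums the geometric series, r ^+ n is left over after n halvings. *)
have iter n d e : 0 < d <= L -> total_energy u p0 d = e%:E ->
    e <= ((4 - p) * S + r ^+ n) * (d `^ (p - p0) * F).
  elim: n d e => [|n IH] d e dL eE; have /andP[d0 dL'] := dL.
    have [e' e'E le] := base d dL.
    have <- : e' = e by move: eE; rewrite e'E => -[].
    apply: (le_trans le); apply: ler_peMl; first by rewrite mulr_ge0 ?powR_ge0.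
    have : 0 <= (4 - p) * S by apply: mulr_ge0; lra.
    by rewrite expr0; lra.
  have d2L : 0 < d / 2 <= L by lra.
  have [e2 e2E _] := base _ d2L.
  have le2 := IH _ _ d2L e2E.
  have [f fE /andP[f0 fF]] := lowfin d dL.
  have [f2 f2E _] := lowfin _ d2L.
  have pp' : p0 <= p by lra.
  have := total_energy_annulus mu d0 pp'.
  rewrite eE e2E fE f2E -!EFinM -!EFinD lee_fin => ann.
  have := total_energy_doubling mu p d; rewrite fE f2E -EFinM lee_fin => dbl.
  have q0 : 0 < 16 * 2 `^ (- p) :> R by rewrite mulr_gt0// powR_gt0.
  have qE : 1 - (16 * 2 `^ (- p))^-1 <= 4 - p.
    have -> : (16 * 2 `^ (- p))^-1 = 2 `^ (- (4 - p)) :> R.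
      have -> : 16 = 2 `^ 4%:R :> R by rewrite powR_mulrn//; ring.
      by rewrite -powRD ?pnatr_eq0 ?implybT// powRN.
    by apply: one_sub_powR_le; lra.
  have f2ge : (16 * 2 `^ (- p))^-1 * f <= f2.
    by rewrite mulrC ler_pdivrMr// mulrC.
  have dg0 : 0 <= d `^ (p - p0) by exact: powR_ge0.
  have dr : (d / 2) `^ (p - p0) = r * d `^ (p - p0).
    by rewrite powRM ?invr_ge0 ?(ltW d0)// mulrC.
  have h1 : e <= d `^ (p - p0) * ((4 - p) * F) + e2.
    suff : d `^ (p - p0) * (f - f2) <= d `^ (p - p0) * ((4 - p) * F) by lra.
    apply: ler_wpM2l => //.
    apply: (@le_trans _ _ ((1 - (16 * 2 `^ (- p))^-1) * f));
      first by rewrite mulrBl; lra.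
    apply: (@le_trans _ _ ((4 - p) * f)); first exact: ler_wpM2r.
    by apply: ler_wpM2l => //; lra.
  apply: (le_trans h1); rewrite dr in le2.
  apply: (@le_trans _ _ (d `^ (p - p0) * ((4 - p) * F) +
    ((4 - p) * S + r ^+ n) * (r * d `^ (p - p0) * F))); first by rewrite lerD2l.
  rewrite le_eqVlt; apply/orP; left; apply/eqP.
  rewrite -[in RHS]Sr exprS; ring.
have [e eE _] := base L ltac:(by rewrite L0 lexx).
rewrite eE FE -EFinM lee_fin.
have le : e <= (4 - p) * S * (L `^ (p - p0) * F).
  rewrite -subr_le0; apply: (@le0_of_geometric _ _ (L `^ (p - p0) * F) r).
  - by rewrite r0/=; lra.
  - by rewrite mulr_ge0 ?powR_ge0.
  move=> n; have := iter n L e ltac:(by rewrite L0 lexx) eE.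
  by rewrite mulrDl [r ^+ n * _]mulrC; lra.
apply: (le_trans le); rewrite /c -mulrA [leLHS]mulrC.
have SE : S <= 3 / (p - p0).
  rewrite -[leRHS]invrK lef_pV2 ?posrE ?invr_gt0; first by rewrite invf_div.
    by lra.
  by rewrite divr_gt0.
have : S * ((4 - p) * (L `^ (p - p0) * F)) <=
  3 / (p - p0) * ((4 - p) * (L `^ (p - p0) * F)).
  by apply: ler_wpM2r => //; rewrite !mulr_ge0 ?powR_ge0//; lra.
lra.
Qed.

(** * Poincare inequality with the Gagliardo seminorm *)

Lemma enorm2_ge0 (R : realType) (x : R * R) : 0 <= enorm2 x.
Proof. exact: sqrtr_ge0. Qed.

Lemma norm_le_enorm2 (R : realType) (x : R * R) : `|x| <= enorm2 x.
Proof.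
rewrite prod_norm_le /enorm2 -!sqrtr_sqr !ler_sqrt ?addr_ge0 ?sqr_ge0//.
by rewrite lerDl lerDr !sqr_ge0.
Qed.

(** With [norm_le_enorm2], the equivalence of norms behind the factor 4 in
[density_le_gagliardo]. *)
Lemma enorm2_le_norm (R : realType) (x : R * R) : enorm2 x <= Num.sqrt 2 * `|x|.
Proof.
rewrite -[X in _ * X]ger0_norm// -sqrtr_sqr -sqrtrM// /enorm2 ler_sqrt
  ?mulr_ge0 ?sqr_ge0//.
have : `|x.1| <= `|x| /\ `|x.2| <= `|x| by apply/andP; rewrite -prod_norm_le.
case=> h1 h2.
rewrite -(real_normK (num_real x.1)) -(real_normK (num_real x.2)).
have : `|x.1| ^+ 2 <= `|x| ^+ 2 by rewrite ler_sqr ?nnegrE.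
have : `|x.2| ^+ 2 <= `|x| ^+ 2 by rewrite ler_sqr ?nnegrE.
by move=> *; lra.
Qed.

Lemma measurable_enorm2 (R : realType) :
  measurable_fun setT (fun z : (measurableTypeR R * measurableTypeR R) *
    (measurableTypeR R * measurableTypeR R) => enorm2 (z.1 - z.2 : R * R)).
Proof.
have ms : measurable_fun setT (Num.sqrt : measurableTypeR R ->
  measurableTypeR R).
  by apply: continuous_measurable_fun; exact: sqrt_continuous.
apply: (measurableT_comp ms); apply: measurable_funD; apply: measurable_funX;
  apply: measurable_funB; apply: measurableT_comp => //.
Qed.

Lemma density_le_gagliardo (R : realType) (u : R * R -> R) (s d : R) z :
  0 < s < 1 ->
  energy_density u (2 + 2 * s) d z <=
  4 * (`|u z.1 - u z.2| ^+ 2 / enorm2 (z.1 - z.2) `^ (2 + 2 * s)).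
Proof.
move=> s01; rewrite /energy_density real_normK ?num_real//.
have D0 : 0 <= (u z.1 - u z.2) ^+ 2 by exact: sqr_ge0.
have e0 : 0 <= enorm2 (z.1 - z.2) by exact: enorm2_ge0.
case: ifP => _; last by rewrite mulr_ge0// mulr_ge0// invr_ge0 powR_ge0.
have [h0|h0] := eqVneq `|z.1 - z.2 : R * R| 0.
  move/eqP: h0; rewrite normr_eq0 subr_eq0 => /eqP ->.
  by rewrite !subrr expr0n/= !mul0r mulr0.
have h : 0 < `|z.1 - z.2 : R * R| by rewrite lt_neqAle eq_sym h0 normr_ge0.
have e : 0 < enorm2 (z.1 - z.2) by exact: lt_le_trans h (norm_le_enorm2 _).
rewrite mulrCA ler_wpM2l// powRN ler_pdivlMr ?powR_gt0// mulrC ler_pdivrMr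
  ?powR_gt0//.
apply: (@le_trans _ _ ((Num.sqrt 2 * `|z.1 - z.2 : R * R|) `^ (2 + 2 * s))).
  by apply: ge0_ler_powR; rewrite ?nnegrE ?mulr_ge0 ?enorm2_le_norm//; lra.
rewrite powRM ?sqrtr_ge0// ler_wpM2r ?powR_ge0//.
have -> : 4 = Num.sqrt 2 `^ 4%:R :> R.
  by rewrite powR_mulrn ?sqrtr_ge0// (exprM _ 2 2) sqr_sqrtr//; ring.
apply: ler_powR; last by lra.
by rewrite -[leLHS]sqrtr1 ler_sqrt//; lra.
Qed.

Definition gagliardo_integral (R : realType) (s : R) (u : R * R -> R) :
  \bar R :=
  (\int[(@lebesgue_measure2 R \x @lebesgue_measure2 R)]_z
     (`|u z.1 - u z.2| ^+ 2 / enorm2 (z.1 - z.2) `^ (2 + 2 * s))%:E)%E.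

Lemma total_energy_le_gagliardo (R : realType) (u : R * R -> R) (s d : R) :
  measurable_fun [set: measurableTypeR R * measurableTypeR R] u -> 0 < s < 1 ->
  (total_energy u (2 + 2 * s) d <= 4%:E * gagliardo_integral s u)%E.
Proof.
move=> mu s01.
pose T : Type := (measurableTypeR R * measurableTypeR R) *
  (measurableTypeR R * measurableTypeR R).
pose g (z : T) : R :=
  `|u z.1 - u z.2| ^+ 2 * enorm2 (z.1 - z.2) `^ (- (2 + 2 * s)).
have mg : measurable_fun setT g.
  apply: measurable_funM.
    apply: measurable_funX; apply: measurableT_comp => //;
      apply: measurable_funB.
      by apply: measurableT_comp => //; exact: measurable_fst.
    by apply: measurableT_comp => //; exact: measurable_snd.
  exact: (measurableT_comp (measurable_powR (- (2 + 2 * s)))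
    (@measurable_enorm2 R)).
have gE z : (`|u z.1 - u z.2| ^+ 2 / enorm2 (z.1 - z.2) `^ (2 + 2 * s)) = g z.
  by rewrite /g powRN.
have g0 z : (0 <= (g z)%:E)%E.
  by rewrite lee_fin mulr_ge0 ?sqr_ge0 ?powR_ge0.
rewrite total_energyE// /gagliardo_integral.
under [X in (_ <= _ * X)%E]eq_integral do rewrite gE.
have mge : measurable_fun setT (fun z => (g z)%:E) by exact/measurable_EFinP.
rewrite -ge0_integralZl; [|exact: measurableT|exact: mge|by move=> z _;
  exact: g0|by []].
apply: ge0_le_integral.
- exact: measurableT.
- by move=> z _; rewrite lee_fin energy_density_ge0.
- by apply/measurable_EFinP; exact: measurable_energy_density.
- by apply: measurable_funeM; exact: mge.
- by move=> z _; rewrite -EFinM lee_fin -gE; exact: density_le_gagliardo.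
Qed.

(** The smallest N with 2 k <= N^2 works, since (N - 1)^2 < 2 k and
N <= 2 (N - 1). *)
Lemma exists_square_between (k : nat) : (0 < k)%N ->
  exists N, [/\ (0 < N)%N, (2 * k <= N ^ 2)%N & (N ^ 2 <= 8 * k)%N].
Proof.
move=> k0.
have ex : exists N, (2 * k <= N ^ 2)%N by exists (2 * k)%N; nia.
case: (ex_minnP ex) => -[|[|N]] h min; [by move: h; nia|by move: h; nia|].
exists N.+2; split=> //.
have : ~~ (2 * k <= N.+1 ^ 2)%N by apply/negP => /min; rewrite ltnn.
by rewrite -ltnNge; nia.
Qed.

Lemma side_powR_le (R : realType) (k N : nat) (rho s : R) :
  0 < rho -> 0 <= s <= 1 -> (N ^ 2 <= 8 * k)%N ->
  (N%:R * (6 * rho)) `^ (2 * s) <= 288 * (k%:R `^ s * rho `^ (2 * s)).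
Proof.
move=> rho0 /andP[s0 s1] Nk.
have C0 : 0 <= 288 :> R by exact: ler0n.
have k0 : 0 <= k%:R :> R by exact: ler0n.
have r2 : 0 <= rho ^+ 2 by exact: sqr_ge0.
have kr : 0 <= k%:R * rho ^+ 2 by exact: mulr_ge0.
have L0 : 0 <= N%:R * (6 * rho).
  by apply: mulr_ge0; [exact: ler0n|apply: mulr_ge0; [exact: ler0n|exact: ltW]].
rewrite powRrM (powR_mulrn 2 L0).
have le : (N%:R * (6 * rho)) ^+ 2 <= 288 * (k%:R * rho ^+ 2).
  rewrite exprMn.
  have -> : 288 * (k%:R * rho ^+ 2) = (8 * k%:R) * (6 * rho) ^+ 2 by ring.
  apply: ler_wpM2r; first exact: sqr_ge0.
  by rewrite -natrX -natrM ler_nat.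
have le' : ((N%:R * (6 * rho)) ^+ 2) `^ s <= (288 * (k%:R * rho ^+ 2)) `^ s.
  apply: (ge0_ler_powR s0 _ _ le); rewrite nnegrE; first exact: sqr_ge0.
  exact: mulr_ge0.
apply: (le_trans le').
rewrite (powRM s C0 kr) (powRM s k0 r2) (powRrM rho) (powR_mulrn 2 (ltW rho0)).
apply: ler_wpM2r; first by apply: mulr_ge0; exact: powR_ge0.
by rewrite -[leRHS](powRr1 C0); apply: ler_powR; [rewrite ler1n|].
Qed.

Section poincare.
Variables (R : realType) (Omega : set (R * R)) (k : nat) (u : R * R -> R).
Variable rho : R.
Hypotheses (k0 : (0 < k)%N) (mc : multiply_connected k Omega) (cu :
  continuous u).
Hypotheses (u0 : forall y, ~ Omega y -> u y = 0) (rho0 : 0 < rho).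
Hypothesis hit : forall x, exists2 p, ~ Omega p & `|p - x| < rho.

Lemma integral_sq_le_total_energy (N : nat) (s L : R) : 2^-1 < s < 1 ->
  (0 < N)%N -> (2 * k <= N ^ 2)%N -> L = N%:R * (6 * rho) ->
  (\int[@lebesgue_measure2 R]_x (u x ^+ 2)%:E <=
   (2640 / (2 * s - 1) * L `^ (2 * s))%:E * total_energy u (2 + 2 * s) L)%E.
Proof.
move=> s01 N0 kN LE; have mu := continuous_measurable2 cu.
have L0 : 0 < L by rewrite LE mulr_gt0 ?ltr0n// mulr_gt0.
have c0 : (0 <= (2640 / (2 * s - 1) * L `^ (2 * s))%:E)%E.
  rewrite lee_fin; apply: mulr_ge0; last exact: powR_ge0.
  by apply: divr_ge0; [exact: ler0n|lra].
have mE := measurable_energy (2 + 2 * s) L mu.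
have E0 x := energy_ge0 u (2 + 2 * s) L x.
rewrite /total_energy -ge0_integralZl//.
apply: (le_integral_tiling L0).
- exact/measurable_EFinP/measurable_funX.
- exact: measurable_funeM.
- by move=> x; rewrite lee_fin sqr_ge0.
- by move=> x; exact: mule_ge0.
move=> b; rewrite ge0_integralZl.
- exact: (le_integral_sq_square b mc cu u0 rho0 hit s01 N0 kN LE).
- exact: measurable_square.
- exact: measurable_funTS.
- by move=> x _; exact: E0.
- exact: c0.
Qed.

(** For s < 3/4 the factor 1 - s is harmless.  For s >= 3/4 the inequality of
exponent 5/8, which is not close to 1/2, is converted into the one of exponent
s by [total_energy_lower_exponent]. *)
Lemma integral_sq_le_gagliardo (s : R) : 2^-1 < s < 1 ->
  (\int[@lebesgue_measure2 R]_x (u x ^+ 2)%:E <=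
   (2640 * 96 * 288 * 4 * ((1 - s) / (2 * s - 1)) * (k%:R `^ s * rho `^ (2 *
     s)))%:E *
   gagliardo_integral s u)%E.
Proof.
move=> s01; have /andP[s2 s1] := s01.
have mu := continuous_measurable2 cu.
have [N [N0 kN Nk]] := exists_square_between k0.
pose L := N%:R * (6 * rho).
have L0 : 0 < L by rewrite mulr_gt0 ?ltr0n// mulr_gt0.
have T0 p d := total_energy_ge0 u p d.
have Ls0 : 0 < L `^ (2 * s) by exact: powR_gt0.
have main : (\int[@lebesgue_measure2 R]_x (u x ^+ 2)%:E <=
   (2640 * 96 * ((1 - s) / (2 * s - 1)) * L `^ (2 * s))%:E *
   total_energy u (2 + 2 * s) L)%E.
  have [s34|s34] := ltP s (3 / 4).
    apply: (le_trans (integral_sq_le_total_energy s01 N0 kN erefl)).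
    apply: lee_wpmul2r; first exact: T0.
    rewrite lee_fin; apply: ler_wpM2r; first exact: ltW.
    rewrite mulrA; apply: ler_wpM2r; first by rewrite invr_ge0; lra.
    have C0 : 0 <= 2640 :> R by exact: ler0n.
    by move: C0; move: (2640 : R) => C C0; nra.
  have t01 : 2^-1 < (5 / 8 : R) < 1 by lra.
  apply: (le_trans (integral_sq_le_total_energy t01 N0 kN erefl)).
  (* Any exponent strictly between 1/2 and 3/4 would do. *)
  have gap : 0 < 2 + 2 * s - (2 + 2 * (5 / 8)) < 1 by lra.
  have := @total_energy_lower_exponent _ u (2 + 2 * (5 / 8)) (2 + 2 * s) L mu L0
    ltac:(lra) gap ltac:(lra).
  set p0 := 2 + 2 * (5 / 8); set g := 2 + 2 * s - p0 => low.
  have c0 : (0 <= (2640 / (2 * (5 / 8) - 1) * L `^ (2 * (5 / 8)))%:E)%E.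
    rewrite lee_fin; apply: mulr_ge0; last exact: powR_ge0.
    by apply: divr_ge0; [exact: ler0n|lra].
  apply: (le_trans (lee_wpmul2l c0 low)); rewrite muleA -EFinM.
  apply: lee_wpmul2r; [exact: T0|rewrite lee_fin].
  clear low c0 T0.
  have -> : L `^ (2 * s) = L `^ (2 * (5 / 8)) * L `^ g.
    by rewrite -powRD ?(gt_eqF L0) ?implybT//; congr (_ `^ _); rewrite /g /p0;
      ring.
  have g4 : 1 / 4 <= g by rewrite /g /p0; lra.
  have P0 : 0 <= L `^ (2 * (5 / 8)) * L `^ g by rewrite mulr_ge0 ?powR_ge0.
  have -> : 2640 / (2 * (5 / 8) - 1) * L `^ (2 * (5 / 8)) *
      (3 / g * (4 - (2 + 2 * s)) * L `^ g) =
    (2640 / (2 * (5 / 8) - 1) * (3 / g * (4 - (2 + 2 * s)))) *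
      (L `^ (2 * (5 / 8)) * L `^ g) by ring.
  apply: ler_wpM2r => //.
  have g3 : 3 / g <= 12 by rewrite ler_pdivrMr; lra.
  have s3 : 1 - s <= (1 - s) / (2 * s - 1).
    by rewrite ler_pdivlMr; [rewrite ler_piMr|]; lra.
  have C0 : 0 <= 2640 :> R by exact: ler0n.
  move: C0; move: (2640 : R) => C C0.
  have -> : C / (2 * (5 / 8) - 1) = C * 4 by field.
  have : 3 / g * (4 - (2 + 2 * s)) <= 12 * (4 - (2 + 2 * s))
    by apply: ler_wpM2r => //; lra.
  move: (3 / g * _) ((1 - s) / _) s3 => A B s3 AB.
  by rewrite -!mulrA; apply: ler_wpM2l => //; lra.
have cs : 0 <= 2640 * 96 * ((1 - s) / (2 * s - 1)).
  by apply: mulr_ge0; [apply: mulr_ge0; exact: ler0n|apply: divr_ge0; lra].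
apply: (le_trans main).
have s0 : 0 < s < 1 by lra.
have c0 : (0 <= (2640 * 96 * ((1 - s) / (2 * s - 1)) * L `^ (2 * s))%:E)%E.
  by rewrite lee_fin; apply: mulr_ge0; [exact: cs|exact: ltW].
apply: (le_trans (lee_wpmul2l c0 (total_energy_le_gagliardo L mu s0))).
rewrite muleA -EFinM; apply: lee_wpmul2r.
  apply: integral_ge0 => z _;
    rewrite lee_fin mulr_ge0 ?sqr_ge0// invr_ge0 powR_ge0 //.
rewrite lee_fin.
have LL : L `^ (2 * s) <= 288 * (k%:R `^ s * rho `^ (2 * s)).
  by apply: side_powR_le => //; lra.
apply: le_trans (ler_wpM2r (ler0n R 4) (ler_wpM2l cs LL)) _.
rewrite le_eqVlt; apply/orP; left; apply/eqP.
by move: ((1 - s) / _) (_ * _ `^ _) (2640 : R) => A B C; ring.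
Qed.

End poincare.

(** * The first eigenvalue and the inradius *)

Lemma poweR_half_sqr (R : realType) (x : \bar R) :
  (0 <= x -> (x `^ (2^-1)%R) ^+ 2 = x)%E.
Proof.
rewrite expe2; case: x => [r| |] r0 //.
  rewrite lee_fin in r0.
  by rewrite poweR_EFin -EFinM powR12_sqrt// -expr2 sqr_sqrtr.
by rewrite /poweR invr_eq0 pnatr_eq0/= mulyy.
Qed.

Lemma gagliardo_sqr (R : realType) (s : R) (u : R * R -> R) :
  (gagliardo s u ^+ 2 = gagliardo_integral s u)%E.
Proof.
apply: poweR_half_sqr; apply: integral_ge0 => z _.
by rewrite lee_fin mulr_ge0 ?sqr_ge0// invr_ge0 powR_ge0.
Qed.

Lemma norm_L2_sqr (R : realType) (Omega : set (R * R)) (u : R * R -> R) :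
  (forall x, ~ Omega x -> u x = 0) ->
  (norm_L2 Omega u ^+ 2 = \int[@lebesgue_measure2 R]_x (u x ^+ 2)%:E)%E.
Proof.
move=> u0; have -> : (norm_L2 Omega u =
    (\int[@lebesgue_measure2 R]_x (u x ^+ 2)%:E) `^ (2^-1)%R)%E.
  rewrite /norm_L2 unlock; congr (_ `^ _)%E; apply: eq_integral => x _ /=.
  have -> : (u \_ Omega) x = u x.
    by rewrite /patch; case: ifPn => // /negP; rewrite inE => /u0 ->.
  by rewrite -[2]/(2%:R) powR_mulrn// real_normK ?num_real.
by apply: poweR_half_sqr; apply: integral_ge0 => x _; rewrite lee_fin sqr_ge0.
Qed.

Lemma integral_sq_gt0 (R : realType) (u : R * R -> R) (x0 : R * R) :
  continuous u -> u x0 != 0 ->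
  (0 < \int[@lebesgue_measure2 R]_x (u x ^+ 2)%:E)%E.
Proof.
move=> cu ux0; have mu := continuous_measurable2 cu.
have c0 : 0 < `|u x0| / 2 by rewrite divr_gt0// normr_gt0.
have /cvgrPdist_lt/(_ _ c0)/(@nbhs_ballP R)[d /= d0 H] := cu x0.
pose S := square x0 (d / 2); have mS : measurable S by exact: measurable_square.
have d20 : 0 < d / 2 by rewrite divr_gt0.
have SE : (@lebesgue_measure2 R S = (d / 2 * (d / 2))%:E)%E.
  rewrite lebesgue_measure2X; try exact: measurable_itv.
  by rewrite !lebesgue_measure_itvco// -EFinM.
have mu2 : measurable_fun setT (fun x :
  measurableTypeR R * measurableTypeR R => (u x ^+ 2)%:E).
  exact/measurable_EFinP/measurable_funX.
apply: (@lt_le_trans _ _ (\int[@lebesgue_measure2 R]_(x in S) (cst ((`|u x0| /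
  2) ^+ 2)%:E x))%E).
  rewrite integral_cst//; apply: mule_gt0; first by rewrite lte_fin exprn_gt0.
  by move: SE => /= ->; rewrite lte_fin mulr_gt0.
apply: (@le_trans _ _ (\int[@lebesgue_measure2 R]_(x in S) (u x ^+ 2)%:E)%E).
  apply: ge0_le_integral.
  - exact: mS.
  - by move=> x _; rewrite lee_fin sqr_ge0.
  - exact: measurable_cst.
  - exact: measurable_funTS.
  move=> x [/= x1 x2]; rewrite lee_fin -[leRHS]real_normK ?num_real//.
  rewrite ler_sqr ?nnegrE ?(ltW c0)//.
  have : `|u x0 - u x| < `|u x0| / 2.
    apply: H; move: x1 x2; rewrite !in_itv/= => /andP[? ?] /andP[? ?].
    by split; rewrite /ball/= ltr_norml; lra.
  have := ler_normB (u x0) (u x0 - u x); rewrite opprB addrC subrK.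
  by have := ler_normD (u x0 - u x) (u x); rewrite subrK; lra.
apply: ge0_subset_integral => //.
by move=> x _; rewrite lee_fin sqr_ge0.
Qed.

(** Without this bound the quotient defining the eigenvalue could be
[G / +oo = 0]. *)
Lemma integral_sq_fin (R : realType) (u : R * R -> R) :
  continuous u -> compact (support2 u) ->
  (\int[@lebesgue_measure2 R]_x (u x ^+ 2)%:E < +oo)%E.
Proof.
move=> cu cs; have mu := continuous_measurable2 cu.
have [M [_ HM]] := compact_bounded cs.
have [M' [_ HM']] : bounded_set (u @` support2 u).
  apply: compact_bounded; apply: continuous_compact => //.
  exact: continuous_subspaceT.
pose B := Num.max 1 (M + 1); pose B' := Num.max 1 (M' + 1).
have B1 : 1 <= B by rewrite le_max lexx.
have supp x : u x != 0 -> support2 u x by move=> ux; exact: subset_closure.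
have uB x : u x != 0 -> `|x| <= B.
  by move=> /supp; apply: HM; rewrite lt_max ltrDl ltr01 orbT.
have uB' x : `|u x| <= B'.
  have [->|/supp ux] := eqVneq (u x) 0; first by rewrite normr0 le_max ler01.
  by apply: HM'; [rewrite lt_max ltrDl ltr01 orbT|exists x].
(* The side 3 B, rather than 2 B, makes room for the half-open square. *)
pose S := square (- B, - B) (3 * B);
  have mS : measurable S by exact: measurable_square.
have B30 : 0 < 3 * B by rewrite mulr_gt0//; lra.
have SE : (@lebesgue_measure2 R S = (3 * B * (3 * B))%:E)%E.
  rewrite lebesgue_measure2X; try exact: measurable_itv.
  by rewrite !lebesgue_measure_itvco// -EFinM.
apply: (@le_lt_trans _ _ (\int[@lebesgue_measure2 R]_(x in S) (cst (B' ^+ 2)%:E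
  x))%E); last first.
  rewrite integral_cst//; move: SE => /= ->.
  by rewrite -EFinM ltry.
rewrite [leRHS]integral_mkcond; apply: ge0_le_integral.
- exact: measurableT.
- by move=> x _; rewrite lee_fin sqr_ge0.
- exact/measurable_EFinP/measurable_funX.
- exact: ((measurable_restrictT (cst (B' ^+ 2)%:E) mS).1 (measurable_cst _)).
move=> x _; rewrite /patch; case: ifPn => [_|/negP xS].
  rewrite lee_fin -[leLHS]real_normK ?num_real// ler_sqr ?nnegrE//.
  by rewrite le_max ler01.
have [->|/uB] := eqVneq (u x) 0; first by rewrite expr0n lexx.
rewrite prod_norm_le !ler_norml => /andP[/andP[? ?] /andP[? ?]].
by case: xS; rewrite inE; split; rewrite /= in_itv/=; apply/andP; split; lra.
Qed.

Lemma inradius_hit (R : realType) (Omega : set (R * R)) (rho : R) :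
  0 < rho -> (inradius Omega < rho%:E)%E ->
  forall x, exists2 p, ~ Omega p & `|p - x| < rho.
Proof.
move=> rho0 inr x.
have [Ox|nOx] := pselect (Omega x); last by exists x; rewrite ?subrr ?normr0.
apply: contrapT => nex.
have sub : disk x rho `<=` Omega.
  move=> p pd; apply: contrapT => nOp; apply: nex; exists p => //.
  exact: le_lt_trans (norm_le_enorm2 _) pd.
have : (rho%:E <= inradius Omega)%E.
  by apply: ereal_sup_ubound; exists rho => //; split => //; exists x.
by rewrite leNgt inr.
Qed.

Lemma inradius_gt0 (R : realType) (Omega : set (R * R)) x :
  open Omega -> Omega x -> (0 < inradius Omega)%E.
Proof.
move=> oO Ox; have /(@nbhs_ballP R)[d /= d0 H] := open_nbhs_nbhs (conj oO Ox).
apply: (@lt_le_trans _ _ d%:E); first by rewrite lte_fin.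
apply: ereal_sup_ubound; exists d => //; split => //; exists x => // p pd.
have := le_lt_trans (norm_le_enorm2 _) pd; rewrite prod_norm_lt => /andP[p1 p2].
by apply: H; split; rewrite /ball/= distrC.
Qed.

Lemma limf_bounded_window (R : realType) (f : R -> \bar R) (F :
  set_system R) (a b : R) (V : set R) :
  ProperFilter F -> F V -> 0 < a -> (forall s, V s -> a%:E <= f s <= b%:E)%E ->
  [/\ (0 < limf_einf f F)%E, (limf_einf f F <= limf_esup f F)%E
    & (limf_esup f F < +oo)%E].
Proof.
move=> PF FV a0 fab; split.
- apply: (@lt_le_trans _ _ a%:E); first by rewrite lte_fin.
  rewrite limf_einfE; apply: (@le_trans _ _ (ereal_inf (f @` V))).
    by apply: le_ereal_inf_tmp => _ [s Vs <-]; have /andP[] := fab s Vs.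
  by apply: ereal_sup_ubound; exists V.
- rewrite limf_einfE limf_esupE; apply: ge_ereal_sup => _ [A FA <-].
  apply: le_ereal_inf_tmp => _ [B FB <-].
  have [s [As Bs]] := filter_ex (filterI FA FB).
  apply: (@le_trans _ _ (f s)); first by apply: ereal_inf_lbound; exists s.
  by apply: ereal_sup_ubound; exists s.
- apply: (@le_lt_trans _ _ b%:E); last exact: ltry.
  rewrite limf_esupE; apply: (@le_trans _ _ (ereal_sup (f @` V))).
    by apply: ereal_inf_lbound; exists V.
  by apply: ge_ereal_sup => _ [s Vs <-]; have /andP[] := fab s Vs.
Qed.

Lemma quotient_ge_of_le (R : realType) (G : \bar R) (i c K : R) :
  (0 <= G)%E -> 0 < i -> 0 <= c -> c * K <= 1 -> (i%:E <= K%:E * G)%E ->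
  (c%:E <= G / i%:E)%E.
Proof.
move=> G0 i0 c0 cK iG; rewrite inver gt_eqF// muleC lee_pdivlMl//.
have cE : (0 <= c%:E)%E by rewrite lee_fin.
rewrite muleC; apply: (le_trans (lee_wpmul2l cE iG)).
by rewrite muleA -EFinM -[leRHS]mul1e; apply: lee_wpmul2r.
Qed.

Lemma lambda1_ge (R : realType) (s : R) (k : nat) (Omega : set (R * R)) :
  2^-1 < s < 1 -> (0 < k)%N -> open Omega -> multiply_connected k Omega ->
  (((2 * s - 1) / (1 - s) / (2640 * 96 * 288 * 4 * 4) / k%:R `^ s)%:E *
    (inradius Omega)^-1 `^ (2 * s)%R <= lambda1 s Omega)%E.
Proof.
move=> s01 k0 oO mc; have /andP[s2 s1] := s01.
apply: le_ereal_inf_tmp => _ [u [[su cu sO] un0] <-].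
have cont : continuous u by have [] := su [::].
have u0 x : ~ Omega x -> u x = 0.
  move=> nO; apply: contrapT => /eqP ux; apply: nO; apply: sO.
  exact: subset_closure.
have [x0 ux0] : exists x0, u x0 != 0.
  apply: contrapT => nex; apply: un0; apply/funext => x;
    apply: contrapT => /eqP ux.
  by apply: nex; exists x.
have Ox0 : Omega x0 by apply: contrapT => /u0 /eqP; apply/negP.
rewrite gagliardo_sqr norm_L2_sqr//.
have I0 := integral_sq_gt0 cont ux0.
have Ify := integral_sq_fin cont cu.
have G0 : (0 <= gagliardo_integral s u)%E.
  by rewrite -gagliardo_sqr expe2 mule_ge0 ?poweR_ge0.
have C0 : 0 < 2640 * 96 * 288 * 4 :> R by do 3 (apply: mulr_gt0;
  last by rewrite ltr0n); rewrite ltr0n.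
have Gag rho := @integral_sq_le_gagliardo R Omega k u rho k0 mc cont u0.
move: C0 Gag; set C := 2640 * 96 * 288 * 4; clearbody C => C0 Gag.
move: I0 Ify Gag; set I := (\int[_]_x _)%E => I0 Ify Gag.
have IE : I = (fine I)%:E by rewrite fineK// ge0_fin_numE// ltW.
have i0 : 0 < fine I by rewrite -lte_fin -IE.
move: I0 Gag; rewrite IE; move: (fine I) i0 => i i0 _ Gag.
have ks : 0 < k%:R `^ s by apply: powR_gt0; rewrite ltr0n.
have a0 : 0 < (2 * s - 1) / (1 - s) by rewrite divr_gt0; lra.
have inr0 := inradius_gt0 oO Ox0.
case inrE : (inradius Omega) inr0 => [r| |] // inr0; last first.
  (* An infinite inradius makes the lower bound 0. *)
  rewrite invey poweR0r ?mule0; last by rewrite gt_eqF//; lra.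
  by rewrite mule_ge0// inver gt_eqF// lee_fin invr_ge0 ltW.
rewrite lte_fin in inr0.
have rho0 : 0 < 2 * r by rewrite mulr_gt0.
have inr2 : (inradius Omega < (2 * r)%:E)%E by rewrite inrE lte_fin; lra.
have := Gag _ rho0 (inradius_hit rho0 inr2) s s01.
rewrite inver gt_eqF// poweR_EFin -EFinM.
apply: quotient_ge_of_le => //.
  rewrite mulr_ge0 ?powR_ge0// mulr_ge0 ?invr_ge0 ?powR_ge0// mulr_ge0 ?(ltW
    a0)//.
  by rewrite invr_ge0 mulr_ge0// ltW.
have rs : 0 < r `^ (2 * s) by exact: powR_gt0.
have -> : r^-1 `^ (2 * s) = (r `^ (2 * s))^-1.
  by rewrite -powR_inv1 ?(ltW inr0)// -powRrM mulN1r powRN.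
have r4 : (2 * r) `^ (2 * s) <= 4 * r `^ (2 * s).
  rewrite powRM ?(ltW inr0)// ler_pM2r//.
  have -> : 4 = 2 `^ 2%:R :> R by rewrite powR_mulrn//; ring.
  by apply: ler_powR; [rewrite ler1n|lra].
have s20 : 0 < 2 * s - 1 by lra.
have s10 : 0 < 1 - s by lra.
move: (2 * s - 1) (1 - s) (k%:R `^ s) (r `^ (2 * s)) ((2 * r) `^ (2 * s)) s20
  s10 ks rs r4.
move=> x y K P Q x0' y0 K0 P0 PQ.
have -> : x / y / (C * 4) / K * P^-1 * (C * (y / x) * (K * Q)) = Q / (4 * P).
  by field; rewrite !gt_eqF.
by rewrite ler_pdivrMr ?mul1r// mulr_gt0.
Qed.

Theorem theorem1p1 (R : realType) :
  exists theta : R -> R,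
    [/\ forall s : R, 2^-1 < s < 1 ->
          0 < theta s /\
          forall (k : nat) (Omega : set (R * R)), (0 < k)%N ->
            open Omega -> multiply_connected k Omega ->
            ((theta s / k%:R `^ s)%:E * (inradius Omega)^-1 `^ (2 * s)%R
               <= lambda1 s Omega)%E,
        [/\ (0 < limf_einf (fun s : R => (theta s / (2 * s - 1))%:E) (2^-1)^'+)%E,
            (limf_einf (fun s : R => (theta s / (2 * s - 1))%:E) (2^-1)^'+
              <= limf_esup (fun s : R => (theta s / (2 * s - 1))%:E) (2^-1)^'+)%E
          & (limf_esup (fun s : R => (theta s / (2 * s - 1))%:E) (2^-1)^'+ < +oo)%E]
      & [/\ (0 < limf_einf (fun s : R => ((1 - s) * theta s)%:E) 1^'-)%E,
            (limf_einf (fun s : R => ((1 - s) * theta s)%:E) 1^'-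
              <= limf_esup (fun s : R => ((1 - s) * theta s)%:E) 1^'-)%E
          & (limf_esup (fun s : R => ((1 - s) * theta s)%:E) 1^'- < +oo)%E]].
Proof.
exists (fun s => (2 * s - 1) / (1 - s) / (2640 * 96 * 288 * 4 * 4)).
have C0 : 0 < 2640 * 96 * 288 * 4 * 4 :> R.
  by do 4 (apply: mulr_gt0; last by rewrite ltr0n); rewrite ltr0n.
have bound := @lambda1_ge R.
move: C0 bound; set C := 2640 * 96 * 288 * 4 * 4; clearbody C => C0 bound.
split.
- move=> s s01; split; last by move=> k Omega; exact: bound.
  by rewrite !divr_gt0//; lra.
- apply: (@limf_bounded_window _ _ _ (1 / C) (4 / C) [set s | 2^-1 < s < 3 / 4]).
  + near=> s; apply/andP; split; near: s; first exact: nbhs_right_gt.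
    by apply: nbhs_right_lt; lra.
  + by rewrite divr_gt0.
  move=> s /= s34.
  have -> : (2 * s - 1) / (1 - s) / C / (2 * s - 1) = (1 - s)^-1 / C.
    by field; rewrite !gt_eqF//; lra.
  rewrite !lee_fin !ler_pM2r ?invr_gt0//.
  have s1 : 0 < 1 - s by lra.
  by rewrite -[(1 - s)^-1]mul1r ler_pdivlMr// ler_pdivrMr//; lra.
- apply: (@limf_bounded_window _ _ _ (2^-1 / C) (1 / C) [set s | 3 / 4 < s < 1]).
  + near=> s; apply/andP; split; near: s; last exact: nbhs_left_lt.
    by apply: nbhs_left_gt; lra.
  + by rewrite divr_gt0.
  move=> s /= s34.
  have -> : (1 - s) * ((2 * s - 1) / (1 - s) / C) = (2 * s - 1) / C.
    by field; rewrite !gt_eqF//; lra.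
  by rewrite !lee_fin !ler_pM2r ?invr_gt0//; lra.
Unshelve. all: by end_near. Qed.
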